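(* Let $\lambda>0$, $\rho>0$, $a>1$, $\sigma\in(0,1]$, $0<\gamma<\sigma/2$. Let $\varsigma\in(0,1)$, $0<\tau<(1-\varsigma)L_{\Xi}^{-1}$, $0<\beta_{\max}\le\frac{\sqrt{\varsigma(\tau^{-1}-L_{\Xi})\tau^{-1}}}{2(\tau^{-1}+L_{\Xi})}$, $x^0\in\mathcal{S}$, $x^{-1}=x^0$, and let $\{x^k\}_{k\in\mathbb{N}}$ be any (infinite) sequence generated by $$\widetilde{x}^k=x^k+\beta_k(x^k-x^{k-1}),\qquad x^{k+1}\in\mathcal{P}_{\tau}h_{\lambda,\rho}\big(\widetilde{x}^k-\tau\nabla\Xi_{\sigma,\gamma}(\widetilde{x}^k)\big),\qquad k=0,1,2,\ldots,$$ with arbitrary $\beta_k\in[0,\beta_{\max}]$. Then: (i) $\sum_{k=1}^{\infty}\|x^{k+1}-x^k\|<\infty$, and consequently $\{x^k\}_{k\in\mathbb{N}}$ converges to some $x^*\in S_{\tau,h_{\lambda,\rho}}$. (ii) If $G_{\sigma,\gamma,\rho}$ is a KL function of exponent $1/2$, then there exist $c_2>0$ and $\varrho\in(0,1)$ such that for all sufficiently large $k$, $\|x^k-x^*\|\le c_2\varrho^k$.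
   Context: $\mathcal{S}=\{x\in\mathbb{R}^n:\|x\|=1\}$; $\delta_{\mathcal{S}}$ is its indicator function ($0$ on $\mathcal{S}$, $+\infty$ elsewhere). $A\in\mathbb{R}^{m\times n}$ is a given matrix ($A=\mathrm{Diag}(b)\Phi$ with $b\in\{-1,1\}^m$, $\Phi\in\mathbb{R}^{m\times n}$), and $f_{\sigma,\gamma}(x):=\sum_{i=1}^m\vartheta_{\sigma,\gamma}((Ax)_i)$, where $$\vartheta_{\sigma,\gamma}(t)=\begin{cases}0 & t>0,\\ t^2/(2\gamma) & -\gamma<t\le 0,\\ -t-\gamma/2 & -\sigma+\gamma<t\le-\gamma,\\ \sigma-\frac{\gamma}{2}-\frac{(t+\sigma+\gamma)^2}{4\gamma} & -(\sigma+\gamma)\le t\le\gamma-\sigma,\\ \sigma-\gamma/2 & t<-(\sigma+\gamma).\end{cases}$$ Let $$\psi^*(\omega)=\begin{cases}0 & \omega\le\frac{2}{a+1},\\ \frac{((a+1)\omega-2)^2}{4(a^2-1)} & \frac{2}{a+1}<\omega\le\frac{2a}{a+1},\\ \omega-1 & \omega>\frac{2a}{a+1}.\end{cases}$$ Define $\Xi_{\sigma,\gamma}(x):=f_{\sigma,\gamma}(x)-\lambda\sum_{i=1}^n\psi^*(\rho|x_i|)$, $h_{\lambda,\rho}(x):=\delta_{\mathcal{S}}(x)+\lambda\rho\|x\|_1$, and $G_{\sigma,\gamma,\rho}:=\Xi_{\sigma,\gamma}+h_{\lambda,\rho}$. The function $\Xi_{\sigma,\gamma}$ is continuously differentiable and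 $L_{\Xi}$ denotes the Lipschitz constant of $\nabla\Xi_{\sigma,\gamma}$ (with $L_{\Xi}\le\gamma^{-1}\|A\|^2+\lambda\rho^2\max(\frac{a+1}{2},\frac{a+1}{2(a-1)})$). For a proper lower semicontinuous $h$ and $\tau>0$, the (set-valued) proximal mapping is $\mathcal{P}_{\tau}h(x):=\arg\min_{z\in\mathbb{R}^n}\{\frac{1}{2\tau}\|z-x\|^2+h(z)\}$. $S_{\tau,h_{\lambda,\rho}}$ is the set of $\tau$-stationary points: $x\in S_{\tau,h_{\lambda,\rho}}$ iff $x\in\mathcal{P}_{\tau}h_{\lambda,\rho}(x-\tau\nabla\Xi_{\sigma,\gamma}(x))$. KL property: a proper lower semicontinuous $h:\mathbb{R}^n\to(-\infty,+\infty]$ has the KL property of exponent $\theta\in[0,1)$ at $\overline{x}\in\mathrm{dom}\,\partial h$ if there exist $\eta\in(0,+\infty]$, a neighborhood $\mathcal{U}$ of $\overline{x}$ and $c>0$ such that, with $\varphi(t)=ct^{1-\theta}$, $\varphi'(h(x)-h(\overline{x}))\,\mathrm{dist}(0,\partial h(x))\ge 1$ for all $x\in\mathcal{U}$ with $h(\overline{x})<h(x)<h(\overline{x})+\eta$. Here $\partial h$ is the limiting (Mordukhovich) subdifferential. $h$ is a KL function of exponent $\theta$ if this holds at every point of $\mathrm{dom}\,\partial h$. *)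

(* Defs.v *)
From HB Require Import structures.
From mathcomp Require Import all_boot all_order all_algebra.
From mathcomp Require Import all_classical all_reals all_analysis.
Import Order.TTheory GRing.Theory Num.Theory.
Import numFieldNormedType.Exports.

Set Implicit Arguments.
Unset Strict Implicit.
Unset Printing Implicit Defensive.

Local Open Scope classical_set_scope.
Local Open Scope ring_scope.

(* The library norm `|x| on 'cV[R]_n is the sup norm, so the Euclidean norm is
   defined here.  Both induce the same topology, so neighbourhoods and limits
   in 'cV[R]_n below are those of the library. *)
Definition dotv (R : realType) (n : nat) (u v : 'cV[R]_n) : R :=
  \sum_(i < n) u i 0 * v i 0.

Definition enorm (R : realType) (n : nat) (x : 'cV[R]_n) : R :=
  Num.sqrt (\sum_(i < n) x i 0 ^+ 2).

Definition norm1 (R : realType) (n : nat) (x : 'cV[R]_n) : R :=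
  \sum_(i < n) `|x i 0|.

Definition sphere (R : realType) (n : nat) : set 'cV[R]_n :=
  [set x | enorm x = 1].

Definition indicator (R : realType) (n : nat) (S : set 'cV[R]_n)
  (x : 'cV[R]_n) : \bar R := if x \in S then 0%E else +oo%E.

Definition gradient (R : realType) (n : nat) (F : 'cV[R]_n -> R)
  (x : 'cV[R]_n) : 'cV[R]_n := \col_(i < n) 'D_(delta_mx i 0) F x.

(* The least Lipschitz constant of F for the Euclidean norm.  For a map that is
   not Lipschitz, sup takes the default value 0. *)
Definition lipschitz_const (R : realType) (n : nat)
  (F : 'cV[R]_n -> 'cV[R]_n) : R :=
  sup [set enorm (F p.1 - F p.2) / enorm (p.1 - p.2) |
       p in [set p : 'cV[R]_n * 'cV[R]_n | p.1 != p.2]].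

Definition argmin (R : realType) (T : Type) (F : T -> \bar R) : set T :=
  [set z | forall y, (F z <= F y)%E].

Definition prox (R : realType) (n : nat) (tau : R) (h : 'cV[R]_n -> \bar R)
  (x : 'cV[R]_n) : set 'cV[R]_n :=
  argmin (fun z => ((1 / (2 * tau) * enorm (z - x) ^+ 2)%:E + h z)%E).

(* v is a regular (Frechet) subgradient of h at x when
   h z >= h x + <v, z - x> + o(||z - x||) as z tends to x. *)
Definition regular_subdiff (R : realType) (n : nat) (h : 'cV[R]_n -> \bar R)
  (x : 'cV[R]_n) : set 'cV[R]_n :=
  [set v | h x \is a fin_num /\
    forall e : R, 0 < e -> \forall z \near x,
      (h x + (dotv v (z - x) - e * enorm (z - x))%:E <= h z)%E].

Definition limiting_subdiff (R : realType) (n : nat) (h : 'cV[R]_n -> \bar R)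
  (x : 'cV[R]_n) : set 'cV[R]_n :=
  [set v | h x \is a fin_num /\
    exists (y w : nat -> 'cV[R]_n),
      [/\ y k @[k --> \oo] --> x,
          h (y k) @[k --> \oo] --> h x,
          forall k, regular_subdiff h (y k) (w k)
        & w k @[k --> \oo] --> v]].

Definition dom_subdiff (R : realType) (n : nat) (h : 'cV[R]_n -> \bar R) :
  set 'cV[R]_n := [set x | limiting_subdiff h x !=set0].

(* Takes the value +oo on the empty set. *)
Definition dist0 (R : realType) (n : nat) (S : set 'cV[R]_n) : \bar R :=
  ereal_inf [set (enorm v)%:E | v in S].

Definition KL_at (R : realType) (n : nat) (h : 'cV[R]_n -> \bar R)
  (theta : R) (xbar : 'cV[R]_n) : Prop :=
  exists (eta : \bar R) (U : set 'cV[R]_n) (c : R),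
    [/\ (0 < eta)%E, nbhs xbar U, 0 < c &
      forall x, U x -> (h xbar < h x)%E -> (h x < h xbar + eta)%E ->
        (1 <= (derive1 (fun t : R => c * t `^ (1 - theta))
                 (fine (h x - h xbar)%E))%:E
              * dist0 (limiting_subdiff h x))%E].

Definition KL_function (R : realType) (n : nat) (h : 'cV[R]_n -> \bar R)
  (theta : R) : Prop :=
  forall xbar, dom_subdiff h xbar -> KL_at h theta xbar.

(* For 0 < gamma < sigma / 2 the five ranges of the piecewise definition are
   consecutive and cover the line, and are tested here from right to left. *)
Definition vartheta (R : realType) (sigma gamma t : R) : R :=
  if 0 < t then 0
  else if - gamma < t then t ^+ 2 / (2 * gamma)
  else if - sigma + gamma < t then - t - gamma / 2
  else if - (sigma + gamma) <= t then
    sigma - gamma / 2 - (t + sigma + gamma) ^+ 2 / (4 * gamma)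
  else sigma - gamma / 2.

Definition psi_star (R : realType) (a w : R) : R :=
  if w <= 2 / (a + 1) then 0
  else if w <= 2 * a / (a + 1) then
    ((a + 1) * w - 2) ^+ 2 / (4 * (a ^+ 2 - 1))
  else w - 1.

Definition f_loss (R : realType) (m n : nat) (A : 'M[R]_(m, n))
  (sigma gamma : R) (x : 'cV[R]_n) : R :=
  \sum_(i < m) vartheta sigma gamma ((A *m x) i 0).

Definition Xi (R : realType) (m n : nat) (A : 'M[R]_(m, n))
  (lambda rho a sigma gamma : R) (x : 'cV[R]_n) : R :=
  f_loss A sigma gamma x
  - lambda * \sum_(i < n) psi_star a (rho * `|x i 0|).

Definition h_reg (R : realType) (n : nat) (lambda rho : R)
  (x : 'cV[R]_n) : \bar R :=
  (indicator (@sphere R n) x + (lambda * rho * norm1 x)%:E)%E.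

Definition G_obj (R : realType) (m n : nat) (A : 'M[R]_(m, n))
  (lambda rho a sigma gamma : R) (x : 'cV[R]_n) : \bar R :=
  ((Xi A lambda rho a sigma gamma x)%:E + h_reg lambda rho x)%E.

Definition stationary (R : realType) (m n : nat) (A : 'M[R]_(m, n))
  (lambda rho a sigma gamma tau : R) : set 'cV[R]_n :=
  [set x | prox tau (h_reg lambda rho)
             (x - tau *: gradient (Xi A lambda rho a sigma gamma) x) x].

(* Since 0.-1 = 0, at k = 0 this uses the convention x^{-1} = x^0. *)
Definition extrapolate (R : realType) (n : nat) (beta : nat -> R)
  (x : nat -> 'cV[R]_n) (k : nat) : 'cV[R]_n :=
  x k + beta k *: (x k - x k.-1).

Definition inertial_prox_seq (R : realType) (m n : nat) (A : 'M[R]_(m, n))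
  (lambda rho a sigma gamma tau : R) (beta : nat -> R)
  (x : nat -> 'cV[R]_n) : Prop :=
  forall k : nat,
    let xt := extrapolate beta x k in
    prox tau (h_reg lambda rho)
      (xt - tau *: gradient (Xi A lambda rho a sigma gamma) xt) (x k.+1).

(* Main.v *)
Require Import Defs.
From HB Require Import structures.
From mathcomp Require Import all_boot all_order all_algebra.
From mathcomp Require Import all_classical all_reals all_analysis.
From mathcomp Require Import ring lra.
Import Order.TTheory GRing.Theory Num.Theory.
Import numFieldNormedType.Exports.

(** The function Xi is a linear combination of squares of hinges max(0, l),
    with l affine: its one-dimensional ingredients are C^1 with a piecewise
    constant second derivative.  Hence Xi has a first-order Taylor expansion
    with quadratic remainder, its gradient is explicit, and, the assumption on
    tau forcing L > 0, the gradient is L-Lipschitz.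

    Descent.  Comparing x^(k+1) with x^k in the proximal step and using the
    two-sided quadratic bounds on Xi, the bound on betamax gives
      H_(k+1) + delta (D_(k+1)^2 + D_k^2) <= H_k,
    where D_k = |x^k - x^(k-1)| and H_k = G(x^k) + cc D_k^2, while the
    subgradient w^k of G at x^k given by the optimality condition satisfies
    |w^(k+1)| <= Cw (D_(k+1) + D_k).

    Convergence needs a Lojasiewicz inequality for G on the sphere, and the one
    proved here is
      |G(x) - G(xb)|^3 <= K |w|^4       for x on the sphere near xb,
    that is, exponent 3/4 ([hinge_l1_lojasiewicz]).  Fix which hinges are
    active at x, the support of x and its signs.  On the coordinates of the
    support, G and w then coincide with a quadratic function and its gradient
    plus a multiple of x, and the same quadratic has value G(xb) at xb.  As
    there are finitely many such patterns, it suffices to treat one quadratic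
    function q on the sphere ([quadratic_lojasiewicz]): at a noncritical xb
    the residual is bounded below, and at a critical xb the difference of
    values is d.Cd / 2, where d = x - xb and C is the Hessian shifted by the
    multiplier at xb, and the residual is g = C d + nu x.  Three cases remain.
      - xb is not in the range of C: the kernel component of g controls nu,
        so d.Cd = O(|g|^2).
      - xb = C y and y = C z with y.xb = 0: the equation of the sphere forces
        |d|^2 + nu^2 = O(|g|), so d.Cd = O(|g|^(3/2)).
      - xb = C y and y.xb <> 0: nu is comparable to |d|^2 up to O(|g|), which
        together with the kernel component of g gives d.Cd = O(|g|^(4/3)).

    With E_k = H_k - G(xb), xb a cluster point, p_k = E_k^(1/4) and
    s_k = D_k + D_(k-1), the Lojasiewicz inequality and the descent give
      W_(k+1) + s_(k+1) <= W_k,     W_k = s_k + C p_k,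
    as long as x^k stays near xb.  So |x^k - xb| + W_k does not increase: the
    iterates are trapped_near_cluster near xb, the steps are summable, and the sequence
    converges to xb.  Stationarity of xb follows by passing to the limit in the
    proximal condition.

    If G has KL exponent 1/2, the same computation with p_k = E_k^(1/2) applies,
    and now p_k = O(s_k), so W_(k+1) <= q W_k for some q < 1, while
    |x^k - xb| <= W_k. *)

Set Implicit Arguments.
Unset Strict Implicit.
Unset Printing Implicit Defensive.

Local Open Scope classical_set_scope.
Local Open Scope ring_scope.

(** * Euclidean geometry of column vectors *)

Section Euclid.
Context {R : realType} {n : nat}.
Implicit Types (u v w x y : 'cV[R]_n) (a b : R).

Lemma dotvC u v : dotv u v = dotv v u.
Proof. by apply: eq_bigr => i _; rewrite mulrC. Qed.

Lemma dotvDl u v w : dotv (u + v) w = dotv u w + dotv v w.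
Proof. by rewrite -big_split; apply: eq_bigr => i _; rewrite mxE mulrDl. Qed.

Lemma dotvZl a u w : dotv (a *: u) w = a * dotv u w.
Proof. by rewrite mulr_sumr; apply: eq_bigr => i _; rewrite mxE mulrA. Qed.

Lemma dotvDr u v w : dotv w (u + v) = dotv w u + dotv w v.
Proof. by rewrite !(dotvC w) dotvDl. Qed.

Lemma dotvZr a u w : dotv w (a *: u) = a * dotv w u.
Proof. by rewrite !(dotvC w) dotvZl. Qed.

Lemma dotvNl u w : dotv (- u) w = - dotv u w.
Proof. by rewrite -scaleN1r dotvZl mulN1r. Qed.

Lemma dotvNr u w : dotv w (- u) = - dotv w u.
Proof. by rewrite !(dotvC w) dotvNl. Qed.

Lemma dotv0l u : dotv 0 u = 0.
Proof. by rewrite -(scale0r u) dotvZl mul0r. Qed.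

Lemma dotv_delta u i : dotv u (delta_mx i 0) = u i 0.
Proof.
rewrite /dotv (bigD1 i)//= mxE !eqxx mulr1 big1 ?addr0// => j ji.
by rewrite mxE (negbTE ji) mulr0.
Qed.

Definition dotvE := (dotvDl, dotvDr, dotvZl, dotvZr, dotvNl, dotvNr).

Lemma enorm_sqr u : enorm u ^+ 2 = dotv u u.
Proof.
rewrite sqr_sqrtr; last by apply: sumr_ge0 => i _; exact: sqr_ge0.
by apply: eq_bigr => i _; rewrite expr2.
Qed.

Lemma enorm_ge0 u : 0 <= enorm u.
Proof. exact: sqrtr_ge0. Qed.

Lemma dotvv_ge0 u : 0 <= dotv u u.
Proof. by rewrite -enorm_sqr sqr_ge0. Qed.

Lemma dotvv_eq0 u : (dotv u u == 0) = (u == 0).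
Proof.
apply/eqP/eqP => [h|->]; last exact: dotv0l.
apply/colP => i; rewrite mxE.
apply/eqP; rewrite -sqrf_eq0 expr2; apply/eqP.
by apply: (psumr_eq0P _ h) => // j _; rewrite -expr2 sqr_ge0.
Qed.

Lemma enorm_eq0 u : (enorm u == 0) = (u == 0).
Proof. by rewrite -dotvv_eq0 -enorm_sqr sqrf_eq0. Qed.

Lemma enorm0 : enorm (0 : 'cV[R]_n) = 0.
Proof. by apply/eqP; rewrite enorm_eq0. Qed.

Lemma enormZ a u : enorm (a *: u) = `|a| * enorm u.
Proof.
apply/eqP; rewrite -(@eqrXn2 _ 2)// ?mulr_ge0 ?enorm_ge0//.
by rewrite exprMn real_normK ?num_real// !enorm_sqr !dotvE mulrA -expr2.
Qed.

Lemma enormN u : enorm (- u) = enorm u.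
Proof. by rewrite -scaleN1r enormZ normrN1 mul1r. Qed.

Lemma enormB u v : enorm (u - v) = enorm (v - u).
Proof. by rewrite -enormN opprB. Qed.

Lemma cauchy_schwarz u v : `|dotv u v| <= enorm u * enorm v.
Proof.
have [->|v0] := eqVneq v 0; first by rewrite dotvC dotv0l normr0 mulr_ge0 ?enorm_ge0.
have vv : 0 < dotv v v by rewrite lt_def dotvv_eq0 v0 dotvv_ge0.
rewrite -(@ler_pXn2r _ 2)// ?nnegrE ?mulr_ge0 ?enorm_ge0//.
rewrite exprMn real_normK ?num_real// !enorm_sqr.
have := dotvv_ge0 (dotv v v *: u - dotv u v *: v).
rewrite !dotvE (dotvC v u) => h.
by rewrite -subr_ge0 -(pmulr_rge0 _ vv); apply: le_trans h _; rewrite le_eqVlt; apply/orP; left; apply/eqP; ring.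
Qed.

Lemma ler_dotv u v : dotv u v <= enorm u * enorm v.
Proof. exact: le_trans (ler_norm _) (cauchy_schwarz u v). Qed.

Lemma ler_enormD u v : enorm (u + v) <= enorm u + enorm v.
Proof.
rewrite -(@ler_pXn2r _ 2)// ?nnegrE ?addr_ge0 ?enorm_ge0//.
rewrite sqrrD !enorm_sqr !dotvE (dotvC v u).
have := ler_dotv u v; lra.
Qed.

Lemma ler_enorm_dist u v w : enorm (u - w) <= enorm (u - v) + enorm (v - w).
Proof. by rewrite -(subrKA v u (- w)) ler_enormD. Qed.

Lemma enorm_normB u v : `|enorm u - enorm v| <= enorm (u - v).
Proof.
have h1 := ler_enormD (u - v) v; have h2 := ler_enormD (v - u) u.
move: h1 h2; rewrite !subrK (enormB v u) ler_norml; lra.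
Qed.

Lemma ler_coord u i : `|u i 0| <= enorm u.
Proof.
rewrite -(@ler_pXn2r _ 2)// ?nnegrE ?enorm_ge0// real_normK ?num_real// enorm_sqr.
rewrite /dotv (bigD1 i)//= expr2 lerDl.
by apply: sumr_ge0 => j _; rewrite -expr2 sqr_ge0.
Qed.

Lemma ler_mxnorm_enorm u : `|u| <= enorm u.
Proof.
have -> : `|u| = mx_norm u by [].
have [->|/eqP/eqP/mx_norm_neq0[[i j] ->]/=] := eqVneq (mx_norm u) 0.
  exact: enorm_ge0.
by rewrite (ord1 j) ler_coord.
Qed.

Lemma ler_coord_mxnorm u i : `|u i 0| <= `|u|.
Proof.
have -> : `|u| = mx_norm u by [].
by rewrite mx_normrE; exact: (le_bigmax _ (fun k => `|u k.1 k.2|) (i, 0)).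
Qed.

Lemma ler_enorm_mxnorm u : enorm u <= (n%:R + 1) * `|u|.
Proof.
rewrite -(@ler_pXn2r _ 2)// ?nnegrE ?mulr_ge0 ?addr_ge0 ?enorm_ge0//.
rewrite enorm_sqr exprMn; apply: (@le_trans _ _ (n%:R * `|u| ^+ 2)).
  rewrite -[n in n%:R]card_ord -sumr_const mulr_suml; apply: ler_sum => i _.
  by rewrite -expr2 mul1r -real_normK ?num_real// lerXn2r ?nnegrE// ler_coord_mxnorm.
apply: ler_wpM2r; first exact: sqr_ge0.
have : 0 <= n%:R :> R by []. nra.
Qed.

Lemma dotv_mulmx (A : 'M[R]_n) u v : dotv u (A *m v) = dotv (A^T *m u) v.
Proof.
have E p q : dotv p q = (p^T *m q) 0 0.
  by rewrite mxE; apply: eq_bigr => i _; rewrite mxE.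
by rewrite !E trmx_mul trmxK mulmxA.
Qed.

Lemma mulmx_bound m (A : 'M[R]_(m, n)) :
  exists2 k, 0 <= k & forall u, enorm (A *m u) <= k * enorm u.
Proof.
pose k := \sum_(i < m) enorm (row i A)^T ^+ 2.
have k0 : 0 <= k by apply: sumr_ge0 => i _; exact: sqr_ge0.
exists (Num.sqrt k) => [|u]; first exact: sqrtr_ge0.
rewrite /enorm -sqrtrM//; apply: ler_wsqrtr.
rewrite mulr_suml; apply: ler_sum => i _.
have -> : (A *m u) i 0 = dotv (row i A)^T u.
  by rewrite !mxE; apply: eq_bigr => j _; rewrite !mxE.
rewrite -real_normK ?num_real//.
have -> : \sum_(i < n) u i 0 ^+ 2 = enorm u ^+ 2.
  by rewrite enorm_sqr; apply: eq_bigr => j _; rewrite expr2.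
by rewrite -exprMn lerXn2r ?nnegrE ?mulr_ge0 ?enorm_ge0// cauchy_schwarz.
Qed.

Lemma nbhs_enorm x (r : R) : 0 < r -> \forall y \near x, enorm (y - x) < r.
Proof.
move=> r0; have N0 : 0 < n%:R + 1 :> R by rewrite ltr_wpDl.
apply/nbhs_ballP; exists (r / (n%:R + 1)); first by rewrite /= divr_gt0.
move=> y; rewrite -ball_normE /= distrC ltr_pdivlMr// mulrC => h.
exact: le_lt_trans (ler_enorm_mxnorm _) h.
Qed.

Lemma nbhs_enormP x (P : set 'cV[R]_n) :
  nbhs x P <-> exists2 r, 0 < r & forall y, enorm (y - x) < r -> P y.
Proof.
split => [/nbhs_ballP[r /= r0 h]|[r r0 h]].
  exists r => // y yx; apply: h; rewrite -ball_normE /= distrC.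
  exact: le_lt_trans (ler_mxnorm_enorm _) yx.
by near=> y; apply: h; near: y; exact: nbhs_enorm.
Unshelve. all: by end_near. Qed.

Lemma cvg_enormP (s : nat -> 'cV[R]_n) x :
  (forall e, 0 < e -> exists N, forall k, (N <= k)%N -> enorm (s k - x) < e) ->
  s k @[k --> \oo] --> x.
Proof.
move=> h P /nbhs_enormP[r r0 rP]; have [N hN] := h r r0.
by exists N => // k /= Nk; exact/rP/hN.
Qed.

End Euclid.

(** * Quadratic functions on the sphere *)

Section SymInverse.
Context {R : realType} {n : nat} (C : 'M[R]_n) (C_sym : C^T = C).

(** The matrix [W^T C C W] is the Gram matrix of the columns of [C W]. *)
Lemma sym_mulmx_cancel p (W : 'M[R]_(n, p)) : C *m (C *m W) = 0 -> C *m W = 0.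
Proof.
move=> h; apply/matrixP => i j; rewrite [RHS]mxE.
have : dotv (col j (C *m W)) (col j (C *m W)) = 0.
  have -> : col j (C *m W) = C *m col j W by rewrite !colE mulmxA.
  by rewrite dotv_mulmx C_sym colE !mulmxA -[C *m C *m W]mulmxA h mul0mx dotv0l.
by move/eqP; rewrite dotvv_eq0 => /eqP/colP/(_ i); rewrite !mxE.
Qed.

(** A generalized inverse [M] of [C *m C] works: the factors [C] in excess cancel
    on either side by symmetry.  Then [C *m M *m C] is the identity on the range
    of [C], and [1 - C *m M *m C] is the projection onto the kernel.  Moreover the
    first identity shows that every [C u] is of the form [C (C z)]. *)
Lemma sym_pseudo_inverse : exists M : 'M[R]_n,
  C *m C *m M *m C = C /\ C *m M *m C *m C = C.
Proof.
have [M hM] : exists M, C *m C *m M *m (C *m C) = C *m C.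
  by exists (pinvmx (C *m C)); apply: mulmxKpV.
exists M.
have hMt : C *m C *m M^T *m (C *m C) = C *m C.
  by have := congr1 trmx hM; rewrite !trmx_mul C_sym !mulmxA.
have cancel N : C *m C *m N *m (C *m C) = C *m C -> C *m N *m C *m C = C.
  move=> hN; apply/eqP; rewrite -subr_eq0; apply/eqP.
  have -> : C *m N *m C *m C - C = C *m (N *m C *m C - 1%:M).
    by rewrite mulmxBr mulmx1 !mulmxA.
  apply: sym_mulmx_cancel; rewrite !mulmxBr mulmx1 !mulmxA.
  by move: hN; rewrite !mulmxA => ->; rewrite subrr.
split; last exact: cancel hM.
have := congr1 trmx (cancel _ hMt).
by rewrite !trmx_mul C_sym trmxK !mulmxA => ->.
Qed.

End SymInverse.

(** The three lemmas below turn the estimates obtained in the three cases of the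
    critical quadratic into the common form [D ^+ 3 <= K * G ^+ 4].  There [G] is
    the norm of the residual [g], [t] the norm of the displacement, [v] the
    absolute value of the multiplier and [D] the variation of the quadratic. *)
Section Scalar.
Context {R : realType}.
Implicit Types (k D G t v h : R).

Lemma rate_of_sq k D G : 0 <= k -> 0 <= D -> 0 <= G <= 1 ->
  D <= k * G ^+ 2 -> D ^+ 3 <= k ^+ 3 * G ^+ 4.
Proof.
move=> k0 D0 /andP[G0 G1] h.
apply: (@le_trans _ _ ((k * G ^+ 2) ^+ 3)).
  by rewrite lerXn2r ?nnegrE// mulr_ge0// exprn_ge0.
rewrite exprMn -exprM ler_wpM2l ?exprn_ge0//.
by apply: ler_wiXn2l.
Qed.

Lemma rate_of_sqrt_cube k D G : 0 <= k -> 0 <= D -> 0 <= G <= 1 ->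
  D ^+ 2 <= k * G ^+ 3 -> D ^+ 3 <= (1 + k ^+ 3) * G ^+ 4.
Proof.
move=> k0 D0 /andP[G0 G1] h.
rewrite -(@ler_pXn2r _ 2)// ?nnegrE ?mulr_ge0 ?addr_ge0 ?exprn_ge0//.
apply: (@le_trans _ _ ((k * G ^+ 3) ^+ 3)).
  by rewrite -exprM mulnC exprM lerXn2r ?nnegrE ?exprn_ge0// mulr_ge0// exprn_ge0.
rewrite [leLHS]exprMn [leRHS]exprMn -!(exprM G); apply: ler_pM => //; rewrite ?exprn_ge0 //.
- have : 0 <= k ^+ 3 by rewrite exprn_ge0.
  set z := k ^+ 3; nra.
- by apply: ler_wiXn2l.
Qed.

Definition tangent_rate k :=
  (2 * k * (1 + 4 * k ^+ 2)) ^+ 3 * (8 * (1 + 4 * k ^+ 2 * (1 + 4 * k ^+ 2))).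

(** The hypotheses give [v ^+ 2 = O(G * (t + G))], hence
    [D = O(G * (t + G))] and [t ^+ 4 = O(G * (t + G))].  The last bound means
    [(t + G) ^+ 3 = O(G)], and cubing the first one concludes. *)
Lemma rate_of_tangent_case k D G t v : 1 <= k -> 0 <= D -> 0 <= G <= 1 ->
  0 <= t -> 0 <= v -> k ^+ 2 * t <= 2^-1 -> t <= 1 ->
  D <= k * (G + v) ^+ 2 -> v <= k * (t ^+ 2 + G) -> v * t <= k * (G + v ^+ 2) ->
  t ^+ 2 <= k * (v + G) ->
  D ^+ 3 <= tangent_rate k * G ^+ 4.
Proof.
move=> k1 D0 /andP[G0 G1] t0 v0 kt t1 hD hv hvt ht; rewrite /tangent_rate.
have k0 : 0 <= k by lra.
have vle : v <= k * (t + G).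
  by apply: le_trans hv _; apply: ler_wpM2l => //; nra.
have v2 : v ^+ 2 <= 4 * k ^+ 2 * (G * (t + G)).
  have e1 : v ^+ 2 <= k * (t * (v * t)) + k * (G * v).
    have := ler_wpM2l v0 hv; move/le_trans; apply; lra.
  have e2 : k * (t * (v * t)) <= k * (t * (k * (G + v ^+ 2))).
    by rewrite !ler_wpM2l.
  have e3 : k * (t * (k * (G + v ^+ 2))) <= k ^+ 2 * (t * G) + 2^-1 * v ^+ 2.
    have := ler_wpM2r (sqr_ge0 v) kt; lra.
  have e4 : k * (G * v) <= k * (G * (k * (t + G))) by rewrite !ler_wpM2l.
  have e5 : 0 <= k ^+ 2 * (G * G) by rewrite !mulr_ge0// sqr_ge0.
  have e6 : 0 <= k ^+ 2 * (t * G) by rewrite !mulr_ge0// sqr_ge0.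
  lra.
set s := 1 + 4 * k ^+ 2; have s1 : 1 <= s by have := sqr_ge0 k; rewrite /s; lra.
have D1 : D <= 2 * k * s * (G * (t + G)).
  have e1 : (G + v) ^+ 2 <= 2 * (G ^+ 2 + v ^+ 2) by have := sqr_ge0 (G - v); lra.
  have e2 : G ^+ 2 + v ^+ 2 <= s * (G * (t + G)).
    have : 0 <= G * t by rewrite mulr_ge0.
    by rewrite /s; lra.
  have := ler_wpM2l k0 e1; have := ler_wpM2l k0 e2; lra.
have t4 : t ^+ 4 <= 2 * k ^+ 2 * s * (G * (t + G)).
  have e0 : t ^+ 4 <= (k * (v + G)) ^+ 2.
    by rewrite (exprM t 2 2) lerXn2r ?nnegrE ?sqr_ge0 ?mulr_ge0 ?addr_ge0.
  have e1 : (v + G) ^+ 2 <= 2 * (G ^+ 2 + v ^+ 2) by have := sqr_ge0 (G - v); lra.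
  have e2 : G ^+ 2 + v ^+ 2 <= s * (G * (t + G)).
    have : 0 <= G * t by rewrite mulr_ge0.
    by rewrite /s; lra.
  have := ler_wpM2l (sqr_ge0 k) e1; have := ler_wpM2l (sqr_ge0 k) e2.
  by rewrite exprMn in e0; lra.
have c0 : 0 <= 4 * k ^+ 2 * s by rewrite !mulr_ge0// ?sqr_ge0//; lra.
have t3 : (t + G) ^+ 3 <= 8 * (1 + 4 * k ^+ 2 * s) * G.
  have G3 : G ^+ 3 <= G by rewrite -{2}[G]expr1 ler_wiXn2l.
  have [tG|Gt] := lerP t G.
    have : (t + G) ^+ 3 <= (2 * G) ^+ 3.
      by rewrite lerXn2r ?nnegrE ?addr_ge0 ?mulr_ge0//; lra.
    rewrite exprMn => /le_trans; apply.
    have := mulr_ge0 c0 G0; lra.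
  have tp : 0 < t by exact: le_lt_trans G0 Gt.
  have h3 : t ^+ 3 <= 4 * k ^+ 2 * s * G.
    rewrite -(ler_pM2l tp) -exprS; apply: le_trans t4 _.
    have e : G * (t + G) <= 2 * (t * G) by nra.
    have := ler_wpM2l c0 e; lra.
  have : (t + G) ^+ 3 <= (2 * t) ^+ 3.
    by rewrite lerXn2r ?nnegrE ?addr_ge0 ?mulr_ge0//; lra.
  rewrite exprMn => /le_trans; apply; lra.
have s0 : 0 <= 2 * k * s by rewrite !mulr_ge0//; lra.
apply: (@le_trans _ _ ((2 * k * s * (G * (t + G))) ^+ 3)).
  by rewrite lerXn2r ?nnegrE// mulr_ge0// mulr_ge0// addr_ge0.
rewrite [leLHS]exprMn -[leRHS]mulrA ler_wpM2l ?exprn_ge0// [leLHS]exprMn.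
have := ler_wpM2l (exprn_ge0 3 G0) t3; lra.
Qed.

End Scalar.

(** Near a critical point [xb] of a quadratic function on the unit sphere: [C] is
    the Hessian plus the multiplier at [xb], [d] the displacement, and
    [g = C d + nu x] is the residual left by the multiplier [nu] (relative to the
    one at [xb]).  The matrix [N] inverts [C] on its range and [E] projects onto
    the kernel of [C]. *)
Section CriticalQuadratic.
Context {R : realType} {n : nat} (C N E : 'M[R]_n) (xb : 'cV[R]_n) (kC kN kE : R).
Hypotheses (C_sym : C^T = C) (CNC : C *m N *m C = C) (NCC : N *m C *m C = C)
  (defE : E = 1%:M - N *m C) (xb1 : enorm xb = 1)
  (kC0 : 0 <= kC) (kN0 : 0 <= kN) (kE0 : 0 <= kE)
  (hC : forall u, enorm (C *m u) <= kC * enorm u)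
  (hN : forall u, enorm (N *m u) <= kN * enorm u)
  (hE : forall u, enorm (E *m u) <= kE * enorm u).
Variables (x d g : 'cV[R]_n) (nu : R).
Hypotheses (x1 : enorm x = 1) (xE : x = xb + d) (gE : g = C *m d + nu *: x).

Lemma sphere_dotv_dist : dotv d x = enorm d ^+ 2 / 2.
Proof.
have e1 := enorm_sqr xb; have e2 := enorm_sqr x.
by move: e1 e2; rewrite xb1 x1 xE !dotvE (dotvC xb d) enorm_sqr; lra.
Qed.

Lemma multiplier_bound : `|nu| <= enorm g + kC * enorm d.
Proof.
have -> : nu = dotv x g - dotv x (C *m d).
  by rewrite gE !dotvE -enorm_sqr x1; ring.
apply: le_trans (ler_normB _ _) _; apply: lerD.
  by apply: le_trans (cauchy_schwarz _ _) _; rewrite x1 mul1r.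
by apply: le_trans (cauchy_schwarz _ _) _; rewrite x1 mul1r.
Qed.

(** Since [d] is almost tangent to the sphere, [nu] enters through
    [dotv d x = enorm d ^+ 2 / 2] only. *)
Lemma quad_le_multiplier :
  `|dotv d (C *m d)| <= enorm d * enorm g + `|nu| * enorm d ^+ 2 / 2.
Proof.
have -> : dotv d (C *m d) = dotv d g - nu * (enorm d ^+ 2 / 2).
  by rewrite -sphere_dotv_dist gE !dotvE; ring.
apply: le_trans (ler_normB _ _) _; apply: lerD; first exact: cauchy_schwarz.
by rewrite normrM -mulrA (ger0_norm (divr_ge0 (sqr_ge0 _) _)).
Qed.

Lemma enorm_hess_le : enorm (C *m d) <= enorm g + `|nu|.
Proof.
have -> : C *m d = g + (- nu) *: x by rewrite gE scaleNr addrK.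
by apply: le_trans (ler_enormD _ _) _; rewrite enormZ normrN x1 mulr1.
Qed.

Lemma quad_le_sqr : `|dotv d (C *m d)| <= kN * (enorm g + `|nu|) ^+ 2.
Proof.
have -> : dotv d (C *m d) = dotv (C *m d) (N *m (C *m d)).
  by rewrite -{2}C_sym -dotv_mulmx !mulmxA CNC.
apply: le_trans (cauchy_schwarz _ _) _.
apply: (@le_trans _ _ (kN * enorm (C *m d) ^+ 2)).
  rewrite expr2 mulrCA; apply: ler_wpM2l; first exact: enorm_ge0.
  exact: hN.
by rewrite ler_wpM2l// lerXn2r ?nnegrE ?enorm_ge0 ?addr_ge0// ?enorm_ge0// enorm_hess_le.
Qed.

(** The projection onto the kernel of [C] kills [C d]. *)
Lemma kernel_part : E *m g = nu *: (E *m x).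
Proof.
rewrite gE mulmxDr -scalemxAr mulmxA [E *m C](_ : _ = 0) ?mul0mx ?add0r//.
by rewrite defE mulmxBl mul1mx NCC subrr.
Qed.

(** The kernel component of [x] stays away from [0], so [kernel_part] bounds the
    multiplier by a multiple of [enorm g]. *)
Lemma rate_transversal : E *m xb != 0 -> enorm g <= 1 ->
  2 * kE * enorm d <= enorm (E *m xb) ->
  `|dotv d (C *m d)| ^+ 3
    <= (kN * (1 + 2 * kE / enorm (E *m xb)) ^+ 2) ^+ 3 * enorm g ^+ 4.
Proof.
move=> Exb g1 hd; have e0 : 0 < enorm (E *m xb).
  by rewrite lt_def enorm_eq0 Exb enorm_ge0.
have hx : enorm (E *m xb) <= 2 * enorm (E *m x).
  have : enorm (E *m xb) <= enorm (E *m x) + enorm (E *m d).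
    rewrite (_ : E *m xb = E *m x - E *m d); last first.
      by rewrite -mulmxBr xE addrK.
    by apply: le_trans (ler_enormD _ _) _; rewrite enormN.
  have := hE d; lra.
have hv : `|nu| <= 2 * kE / enorm (E *m xb) * enorm g.
  rewrite mulrAC ler_pdivlMr//.
  have : `|nu| * enorm (E *m x) <= kE * enorm g.
    by rewrite -enormZ -kernel_part hE.
  have := ler_wpM2l (normr_ge0 nu) hx; lra.
apply: rate_of_sq; rewrite ?enorm_ge0//.
  by rewrite mulr_ge0// sqr_ge0.
apply: le_trans quad_le_sqr _; rewrite -mulrA -exprMn ler_wpM2l// lerXn2r ?nnegrE//.
- by rewrite addr_ge0// enorm_ge0.
- by rewrite mulr_ge0 ?enorm_ge0 ?addr_ge0// divr_ge0 ?mulr_ge0 ?enorm_ge0.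
- by rewrite mulrDl mul1r lerD2l.
Qed.

Variables (y z : 'cV[R]_n).
Hypotheses (Cy : C *m y = xb) (Cz : C *m z = y).
Let s := dotv y xb.

(** The equation of the sphere, [2 xb.d + |d|^2 = 0], with [xb.d] expanded twice
    through [xb = C y], [y = C z] and [C d = g - nu x].  Its left-hand side is
    positive to second order since [y] is not zero. *)
Lemma sphere_second_order :
  enorm d ^+ 2 + 2 * nu ^+ 2 * (enorm y ^+ 2 + dotv z d)
  = 2 * nu * s - 2 * dotv y g + 2 * nu * dotv z g.
Proof.
have adj u v : dotv (C *m u) v = dotv u (C *m v) by rewrite dotv_mulmx C_sym.
have e1 : dotv xb d = - (enorm d ^+ 2 / 2).
  have := sphere_dotv_dist; rewrite xE dotvDr -enorm_sqr (dotvC d xb); lra.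
have e2 : dotv xb d = dotv y g - nu * (s + dotv y d).
  by rewrite -Cy adj /s -dotvDr -xE gE !dotvE; ring.
have e3 : dotv y d = dotv z g - nu * (enorm y ^+ 2 + dotv z d).
  have yy : dotv y y = dotv z xb by rewrite -{1}Cz adj Cy.
  by rewrite enorm_sqr yy -{1}Cz adj -dotvDr -xE gE !dotvE; ring.
rewrite e3 in e2; rewrite e2 in e1; lra.
Qed.

Let h := enorm y ^+ 2.
Let k1 := 2 * (enorm y + (1 + kC) * enorm z).
Hypotheses (d1 : enorm d <= 1) (g1 : enorm g <= 1)
  (zd : 2 * (enorm z * enorm d) <= h).

Lemma preimage_gt0 : 0 < h.
Proof.
rewrite exprn_gt0// lt_def enorm_ge0 andbT enorm_eq0; apply/negP => /eqP y0.
by move: xb1; rewrite -Cy y0 mulmx0 enorm0 => /eqP; rewrite eq_sym oner_eq0.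
Qed.

Lemma multiplier_le : `|nu| <= 1 + kC.
Proof.
have := multiplier_bound; have := ler_wpM2l kC0 d1; move: g1; rewrite mulr1; lra.
Qed.

Lemma linear_terms_le : - 2 * dotv y g + 2 * nu * dotv z g <= k1 * enorm g.
Proof.
have h1 := cauchy_schwarz y g; have h2 := cauchy_schwarz z g.
have h3 := ler_norm (- dotv y g); have h4 := ler_norm (nu * dotv z g).
rewrite normrN in h3; rewrite normrM in h4.
have := ler_pM (normr_ge0 _) (normr_ge0 _) multiplier_le h2.
rewrite /k1; lra.
Qed.

Lemma sphere_second_order_le :
  enorm d ^+ 2 + nu ^+ 2 * h <= 2 * nu * s + k1 * enorm g.
Proof.
have h0 := cauchy_schwarz z d; have h1 := ler_norm (- dotv z d).
rewrite normrN in h1.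
have h2 : 0 <= h / 2 + dotv z d by move: zd; lra.
have := mulr_ge0 (sqr_ge0 nu) h2.
have := sphere_second_order; have := linear_terms_le; rewrite -/h; lra.
Qed.

(** When [s = 0], the second-order expansion bounds both [enorm d ^+ 2] and
    [nu ^+ 2] by a multiple of [enorm g]. *)
Lemma rate_degenerate : s = 0 ->
  `|dotv d (C *m d)| ^+ 3
    <= (1 + (2 * k1 + k1 ^+ 3 / h) ^+ 3) * enorm g ^+ 4.
Proof.
move=> s0; have h0 := preimage_gt0.
have := sphere_second_order_le; rewrite s0 mulr0 add0r => le0.
have t2 : enorm d ^+ 2 <= k1 * enorm g.
  by apply: le_trans le0; rewrite lerDl mulr_ge0 ?sqr_ge0// ltW.
have v2 : nu ^+ 2 <= k1 / h * enorm g.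
  by rewrite mulrAC ler_pdivlMr//; apply: le_trans le0; rewrite lerDr sqr_ge0.
have k10 : 0 <= k1 by rewrite mulr_ge0// addr_ge0 ?mulr_ge0 ?enorm_ge0// addr_ge0.
apply: rate_of_sqrt_cube; rewrite ?enorm_ge0//.
  by apply: addr_ge0; [rewrite mulr_ge0|apply: divr_ge0; [exact: exprn_ge0|exact: ltW]].
have q := quad_le_multiplier.
have q2 : `|dotv d (C *m d)| ^+ 2 <= 2 * (enorm d ^+ 2 * enorm g ^+ 2)
    + nu ^+ 2 * (enorm d ^+ 2) ^+ 2.
  apply: (@le_trans _ _ ((enorm d * enorm g + `|nu| * enorm d ^+ 2 / 2) ^+ 2)).
    by rewrite lerXn2r ?nnegrE// addr_ge0 ?mulr_ge0 ?enorm_ge0 ?exprn_ge0 ?enorm_ge0.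
  rewrite -(real_normK (num_real nu)).
  have := sqr_ge0 (enorm d * enorm g - `|nu| * enorm d ^+ 2 / 2).
  have := sqr_ge0 (`|nu| * enorm d ^+ 2); lra.
apply: le_trans q2 _; rewrite [leRHS]mulrDl; apply: lerD.
  have := ler_wpM2r (sqr_ge0 (enorm g)) t2; lra.
apply: (@le_trans _ _ ((k1 / h * enorm g) * (k1 * enorm g) ^+ 2)).
  apply: ler_pM; rewrite ?sqr_ge0 ?exprn_ge0 ?enorm_ge0//.
  by rewrite lerXn2r ?nnegrE ?exprn_ge0 ?enorm_ge0// mulr_ge0// enorm_ge0.
by rewrite le_eqVlt; apply/orP; left; apply/eqP; ring.
Qed.

Let k := 1 + (1 + k1) / `|s| + (kE + kN * (1 + kC) + kN) + (2 * `|s| + k1).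

(** When [s] is not zero, the term [2 nu s] dominates [nu ^+ 2], so [nu] is
    comparable to [enorm d ^+ 2] up to [O(enorm g)].  As [E x = E d], the
    kernel component of [g] bounds [nu * d]. *)
Lemma rate_tangent : E *m xb = 0 -> s != 0 ->
  4 * (h + enorm z) * enorm g <= `|s| ->
  4 * (h + enorm z) * (kC * enorm d) <= `|s| ->
  2 * k ^+ 2 * enorm d <= 1 ->
  `|dotv d (C *m d)| ^+ 3 <= tangent_rate k * enorm g ^+ 4.
Proof.
move=> Exb s0 hg hd kd; have h0 := preimage_gt0; have z0 := enorm_ge0 z.
have sp : 0 < `|s| by rewrite normr_gt0.
have kEp := kE0; have kNp := kN0; have zdp := zd.
have k10 : 0 <= k1 by rewrite mulr_ge0// addr_ge0 ?mulr_ge0 ?enorm_ge0// addr_ge0.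
have kd0 : 0 <= (1 + k1) / `|s| by rewrite divr_ge0// addr_ge0.
have kNC : 0 <= kN * (1 + kC) by rewrite mulr_ge0// addr_ge0.
have G0 := enorm_ge0 g; have t0 := enorm_ge0 d; have v0 := normr_ge0 nu.
have vb := multiplier_le; have vm := multiplier_bound.
have v2 : `|nu| ^+ 2 = nu ^+ 2 by rewrite real_normK ?num_real.
have hv : 2 * (h + enorm z) * `|nu| <= `|s|.
  have hz : 0 <= 2 * (h + enorm z) by lra.
  have := ler_wpM2l hz vm; lra.
have hns : `|nu * s| = `|nu| * `|s| by rewrite normrM.
apply: (rate_of_tangent_case (t := enorm d) (v := `|nu|)) => //.
- by rewrite /k; lra.
- by rewrite G0.
- by move: kd; rewrite /k; lra.
- apply: le_trans quad_le_sqr _; rewrite ler_wpM2r ?sqr_ge0//.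
  by rewrite /k; lra.
- apply: (@le_trans _ _ ((1 + k1) / `|s| * (enorm d ^+ 2 + enorm g))); last first.
    by rewrite ler_wpM2r ?addr_ge0 ?sqr_ge0// /k; lra.
  rewrite mulrAC ler_pdivlMr//.
  have e1 := sphere_second_order; have e2 := linear_terms_le.
  have zd1 : dotv z d <= enorm z.
    by apply: le_trans (ler_dotv _ _) _; rewrite -[leRHS]mulr1 ler_wpM2l.
  have e3 := ler_wpM2l (sqr_ge0 nu) zd1.
  have e4 := ler_wpM2l v0 hv; rewrite -v2 in e1 e3.
  have e5 : `|nu| * `|s| <= enorm d ^+ 2 + k1 * enorm g.
    have e6 : 0 <= k1 * enorm g by rewrite mulr_ge0.
    have k1g : `|- 2 * dotv y g + 2 * nu * dotv z g| <= k1 * enorm g.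
      have h2 := cauchy_schwarz z g; have h3 := cauchy_schwarz y g.
      apply: le_trans (ler_normD _ _) _; rewrite !normrM normrN (ger0_norm (ler0n R 2)).
      have := ler_pM (normr_ge0 _) (normr_ge0 _) vb h2.
      rewrite /k1; lra.
    have e7 := ler_norm (- (- 2 * dotv y g + 2 * nu * dotv z g)).
    have e8 := ler_norm (- 2 * dotv y g + 2 * nu * dotv z g).
    rewrite normrN in e7.
    have e9 : `|nu| ^+ 2 * (h + dotv z d) <= `|nu| ^+ 2 * (h + enorm z).
      by rewrite ler_wpM2l ?sqr_ge0// lerD2l.
    rewrite -/h in e1; move: hns; case: (ler0P (nu * s)) => _ hns'; last lra.
    have e10 : 0 <= `|nu| ^+ 2 * (h + dotv z d).
      rewrite mulr_ge0 ?sqr_ge0//.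
      have := cauchy_schwarz z d; have := ler_norm (- dotv z d).
      by move: zd; rewrite normrN; lra.
    have := sqr_ge0 (enorm d); lra.
  have e6 : 0 <= k1 * enorm d ^+ 2 by rewrite mulr_ge0// sqr_ge0.
  lra.
- have Ed : E *m x = E *m d by rewrite xE mulmxDr Exb add0r.
  have e1 : `|nu| * enorm (E *m d) <= kE * enorm g.
    by rewrite -Ed -enormZ -kernel_part hE.
  have e2 : enorm d <= enorm (E *m d) + kN * (enorm g + `|nu|).
    have {1}-> : d = E *m d + N *m (C *m d).
      by rewrite defE mulmxBl mul1mx mulmxA subrK.
    apply: le_trans (ler_enormD _ _) _; rewrite lerD2l.
    by apply: le_trans (hN _) _; rewrite ler_wpM2l// enorm_hess_le.
  have e3 := ler_wpM2l v0 e2.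
  have e4 : kN * (`|nu| * enorm g) <= kN * ((1 + kC) * enorm g).
    by rewrite ler_wpM2l// ler_wpM2r.
  apply: (@le_trans _ _ ((kE + kN * (1 + kC) + kN) * (enorm g + `|nu| ^+ 2))).
    have e5 : 0 <= (kE + kN * (1 + kC)) * `|nu| ^+ 2.
      by rewrite mulr_ge0 ?sqr_ge0// addr_ge0.
    have e6 : 0 <= kN * enorm g by rewrite mulr_ge0.
    lra.
  by rewrite ler_wpM2r ?addr_ge0 ?sqr_ge0// /k; lra.
- apply: (@le_trans _ _ ((2 * `|s| + k1) * (`|nu| + enorm g))); last first.
    by rewrite ler_wpM2r ?addr_ge0// /k; lra.
  have e1 := sphere_second_order_le; have e2 := ler_norm (nu * s).
  have e3 : 0 <= nu ^+ 2 * h by rewrite mulr_ge0 ?sqr_ge0// ltW.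
  have e4 : 0 <= k1 * `|nu| by rewrite mulr_ge0.
  have e5 : 0 <= `|s| * enorm g by rewrite mulr_ge0.
  rewrite hns in e2; lra.
Qed.

End CriticalQuadratic.

Section QuadraticLojasiewicz.
Context {R : realType} {n : nat}.
Implicit Types (x xb : 'cV[R]_n).

Lemma critical_quadratic_rate (C : 'M[R]_n) xb :
  C^T = C -> enorm xb = 1 ->
  exists r K, [/\ 0 < r, 0 <= K & forall x d g nu,
    enorm x = 1 -> x = xb + d -> g = C *m d + nu *: x ->
    enorm d <= r -> enorm g <= r ->
    `|dotv d (C *m d)| ^+ 3 <= K * enorm g ^+ 4].
Proof.
move=> C_sym xb1; have [M [C1 C2]] := sym_pseudo_inverse C_sym.
pose N := C *m M; pose E := 1%:M - N *m C.
have CNC : C *m N *m C = C by rewrite /N mulmxA.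
have NCC : N *m C *m C = C by [].
have defE : E = 1%:M - N *m C by [].
have [kC kC0 hC] := mulmx_bound C; have [kN kN0 hN] := mulmx_bound N.
have [kE kE0 hE] := mulmx_bound E.
(* radii are capped at 1 so that powers of small quantities can be compared *)
have minr1 a : 0 < a -> exists r : R, [/\ 0 < r, r <= 1 & r <= a].
  by move=> a0; exists (Num.min 1 a); rewrite lt_min ltr01 a0 !ge_min !lexx orbT.
have [Exb|Exb] := eqVneq (E *m xb) 0; last first.
  have e0 : 0 < enorm (E *m xb) by rewrite lt_def enorm_eq0 Exb enorm_ge0.
  have kE1 : 0 < 2 * kE + 1 by lra.
  have [r [r0 r1 rE]] := minr1 _ (divr_gt0 e0 kE1).
  exists r, ((kN * (1 + 2 * kE / enorm (E *m xb)) ^+ 2) ^+ 3).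
  split=> [//||x d g nu x1 xE gE hd hg].
    by rewrite exprn_ge0// mulr_ge0// sqr_ge0.
  apply: (rate_transversal C_sym CNC NCC defE kN0 kE0 hN hE x1 xE gE Exb).
    exact: le_trans hg r1.
  have := le_trans hd rE; rewrite ler_pdivlMr//; have := enorm_ge0 d; lra.
have xbC : xb = N *m C *m xb.
  by move/eqP: Exb; rewrite /E mulmxBl mul1mx subr_eq0 => /eqP.
pose z := M *m C *m (M *m C *m xb); pose y := C *m z.
(* xb is fixed by C M C, and C = C C M C lifts it twice through C *)
have Cy : C *m y = xb by rewrite /y /z !mulmxA C1 -/N -xbC.
have Cz : C *m z = y by [].
have h0 := preimage_gt0 xb1 Cy.
set h := enorm y ^+ 2 in h0; have z0 := enorm_ge0 z.
pose r2 := h / (2 * (enorm z + 1)).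
have r20 : 0 < r2 by rewrite divr_gt0// mulr_gt0// ltr_wpDl.
have zdP (d : 'cV[R]_n) : enorm d <= r2 -> 2 * (enorm z * enorm d) <= h.
  rewrite ler_pdivlMr; last by rewrite mulr_gt0// ltr_wpDl.
  have := enorm_ge0 d; lra.
pose k1 := 2 * (enorm y + (1 + kC) * enorm z).
have k10 : 0 <= k1 by rewrite mulr_ge0// addr_ge0 ?mulr_ge0 ?enorm_ge0// addr_ge0.
have [s0|s0] := eqVneq (dotv y xb) 0.
  have [r [r0 r1 rE]] := minr1 _ r20.
  exists r, (1 + (2 * k1 + k1 ^+ 3 / h) ^+ 3).
  split=> [//||x d g nu x1 xE gE hd hg].
    rewrite addr_ge0// exprn_ge0//; apply: addr_ge0; first by rewrite mulr_ge0.
    by apply: divr_ge0; [exact: exprn_ge0|exact: ltW].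
  apply: (rate_degenerate C_sym xb1 kC0 hC x1 xE gE Cy Cz) => //.
  - exact: le_trans hd r1.
  - exact: le_trans hg r1.
  - exact/zdP/(le_trans hd).
have sp : 0 < `|dotv y xb| by rewrite normr_gt0.
pose k := 1 + (1 + k1) / `|dotv y xb| + (kE + kN * (1 + kC) + kN) + (2 * `|dotv y xb| + k1).
have k1' : 1 <= k.
  have : 0 <= (1 + k1) / `|dotv y xb| by rewrite divr_ge0// addr_ge0.
  have : 0 <= kN * (1 + kC) by rewrite mulr_ge0// addr_ge0.
  by rewrite /k; lra.
pose c := 4 * (h + enorm z) * (1 + kC) + 1.
have c0 : 0 <= 4 * (h + enorm z) * (1 + kC) by rewrite !mulr_ge0// addr_ge0// ltW.
have [r4 [r40 r41 r42]] := minr1 _ (divr_gt0 sp (ltr_wpDl c0 ltr01)).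
have [r5 [r50 r51 r52]] := minr1 _ r20.
have kk : 0 < 2 * k ^+ 2 by rewrite mulr_gt0// exprn_gt0//; lra.
pose r := Num.min (Num.min r4 r5) (2 * k ^+ 2)^-1.
have hr u : u <= r -> [/\ u <= r4, u <= r5 & 2 * k ^+ 2 * u <= 1].
  rewrite !le_min => /andP[/andP[-> ->]].
  by rewrite -[X in _ <= X -> _]mul1r ler_pdivlMr// mulrC => ->.
exists r, (tangent_rate k); split=> [||x d g nu x1 xE gE hd hg].
- by rewrite !lt_min r40 r50 invr_gt0.
- rewrite /tangent_rate; have k0 : 0 <= k by lra.
  have q0 : 0 <= 4 * k ^+ 2 by rewrite mulr_ge0// sqr_ge0.
  have q1 : 0 <= 1 + 4 * k ^+ 2 by rewrite addr_ge0.
  apply: mulr_ge0; first by rewrite exprn_ge0// mulr_ge0// mulr_ge0.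
  by rewrite mulr_ge0// addr_ge0// mulr_ge0.
have [hd4 hd5 hdk] := hr _ hd; have [hg4 hg5 hgk] := hr _ hg.
have sm u : 0 <= u -> u <= r4 -> 4 * (h + enorm z) * ((1 + kC) * u) <= `|dotv y xb|.
  move=> u0 /le_trans/(_ r42); rewrite ler_pdivlMr; last by rewrite ltr_wpDl.
  by have := u0; lra.
have hz : 0 <= 4 * (h + enorm z) by rewrite mulr_ge0// addr_ge0// ltW.
apply: (rate_tangent C_sym CNC NCC defE xb1 kC0 kN0 kE0 hC hN hE x1 xE gE Cy Cz) => //.
- exact: le_trans hd5 r51.
- exact: le_trans hg5 r51.
- exact/zdP/(le_trans hd5).
- apply: le_trans (sm _ (enorm_ge0 g) hg4); rewrite ler_wpM2l// ler_peMl ?enorm_ge0//.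
  by rewrite lerDl.
- apply: le_trans (sm _ (enorm_ge0 d) hd4); rewrite ler_wpM2l// ler_wpM2r ?enorm_ge0//.
  by rewrite lerDr.
Qed.

(** The Lojasiewicz inequality of exponent 3/4 for a quadratic function on the
    unit sphere: the residual [gq x + mu *: x] is compared with the best
    multiplier at [xb].  Where the residual is bounded below there is nothing to
    prove, as the function is bounded near [xb]; this covers the noncritical
    points. *)
Lemma quadratic_lojasiewicz (B : 'M[R]_n) (q : 'cV[R]_n -> R)
    (gq : 'cV[R]_n -> 'cV[R]_n) xb :
  B^T = B ->
  (forall x d, q (x + d) = q x + dotv (gq x) d + dotv d (B *m d) / 2) ->
  (forall x d, gq (x + d) = gq x + B *m d) ->
  enorm xb = 1 ->
  exists r K, [/\ 0 < r, 0 <= K & forall x mu,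
    enorm x = 1 -> enorm (x - xb) <= r ->
    `|q x - q xb| ^+ 3 <= K * enorm (gq x + mu *: x) ^+ 4].
Proof.
move=> B_sym qE gqE xb1; have [kB kB0 hB] := mulmx_bound B.
pose w0 := gq xb; pose Q := enorm w0 + kB.
have Q0 : 0 <= Q by rewrite addr_ge0// enorm_ge0.
have hQ x : enorm (x - xb) <= 1 -> `|q x - q xb| <= Q.
  set d := x - xb => d1; have -> : x = xb + d by rewrite addrC subrK.
  clearbody d.
  rewrite qE (_ : _ - q xb = dotv (gq xb) d + dotv d (B *m d) / 2); last by ring.
  apply: le_trans (ler_normD _ _) _; apply: lerD.
    by apply: le_trans (cauchy_schwarz _ _) _; rewrite ler_piMr// enorm_ge0.
  rewrite normrM normfV normr_nat -[leRHS]mulr1; apply: ler_pM => //; last lra.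
  apply: le_trans (cauchy_schwarz _ _) _; rewrite -[kB]mul1r.
  apply: ler_pM; rewrite ?enorm_ge0//; apply: le_trans (hB _) _.
  by rewrite ler_piMr.
(* the inequality is trivial as soon as the residual is at least r *)
have away r x mu : 0 < r -> enorm (x - xb) <= 1 -> r <= enorm (gq x + mu *: x) ->
    `|q x - q xb| ^+ 3 <= Q ^+ 3 / r ^+ 4 * enorm (gq x + mu *: x) ^+ 4.
  move=> r0 d1 rw; apply: (@le_trans _ _ (Q ^+ 3)).
    by rewrite lerXn2r ?nnegrE// hQ.
  rewrite mulrAC ler_pdivlMr ?exprn_gt0//.
  apply: ler_wpM2l; first exact: exprn_ge0.
  by rewrite lerXn2r ?nnegrE ?enorm_ge0// ltW.
pose mu0 := - dotv w0 xb; pose p := w0 + mu0 *: xb.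
have pxb : dotv p xb = 0.
  by rewrite /p dotvDl dotvZl -enorm_sqr xb1 /mu0; ring.
have [p0|p0] := eqVneq p 0.
  pose C := B + mu0%:M.
  have C_sym : C^T = C by rewrite /C linearD /= B_sym tr_scalar_mx.
  have CE u : C *m u = B *m u + mu0 *: u by rewrite mulmxDl mul_scalar_mx.
  have [r [K [r0 K0 hr]]] := critical_quadratic_rate C_sym xb1.
  have w0E : w0 = - mu0 *: xb by apply/eqP; rewrite -subr_eq0 scaleNr opprK; apply/eqP.
  exists (Num.min 1 r), (K + Q ^+ 3 / r ^+ 4).
  split=> [||x mu x1]; first by rewrite lt_min ltr01.
    by rewrite addr_ge0// divr_ge0// exprn_ge0// ltW.
  rewrite le_min => /andP[d1 dr].
  have [gr|gr] := lerP (enorm (gq x + mu *: x)) r; last first.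
    apply: le_trans (away r _ mu r0 d1 (ltW gr)) _.
    by rewrite ler_wpM2r ?exprn_ge0 ?enorm_ge0// lerDr.
  pose d := x - xb; have xE : x = xb + d by rewrite addrC subrK.
  have gE : gq x + mu *: x = C *m d + (mu - mu0) *: x.
    rewrite {1}xE gqE -/w0 w0E CE scalerBl xE.
    rewrite !scalerDr !scaleNr; apply/matrixP => i j; rewrite !mxE; ring.
  have := hr x d _ (mu - mu0) x1 xE gE dr gr => h.
  apply: (@le_trans _ _ (`|dotv d (C *m d)| ^+ 3)); last first.
    by apply: le_trans h _; rewrite ler_wpM2r ?exprn_ge0 ?enorm_ge0// lerDl divr_ge0// exprn_ge0// ltW.
  have -> : q x - q xb = dotv d (C *m d) / 2.
    have e1 : dotv d xb = - (dotv d d / 2).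
      have := enorm_sqr xb; have := enorm_sqr x; clearbody d.
      by rewrite x1 xb1 xE !dotvE (dotvC xb d); lra.
    rewrite xE; clearbody d; rewrite qE -/w0 w0E CE !dotvE (dotvC xb d) e1; lra.
  rewrite normrM normfV normr_nat.
  rewrite lerXn2r ?nnegrE ?mulr_ge0 ?invr_ge0// ler_piMr//; lra.
pose e := enorm p; have e0 : 0 < e by rewrite lt_def enorm_eq0 p0 enorm_ge0.
pose Q2 := 2 * kB + enorm w0 + 1.
have Q20 : 0 < Q2 by have := enorm_ge0 w0; rewrite /Q2; lra.
pose r := Num.min 1 (e / (2 * Q2)).
exists r, (Q ^+ 3 / (e / 2) ^+ 4); split=> [||x mu x1].
- by rewrite lt_min ltr01 divr_gt0// mulr_gt0.
- by rewrite divr_ge0// exprn_ge0// divr_ge0// ltW.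
rewrite le_min => /andP[d1 dr]; apply: away => //; first by rewrite divr_gt0.
move: d1 dr; set d := x - xb; have xE : x = xb + d by rewrite addrC subrK.
clearbody d => d1; rewrite ler_pdivlMr ?mulr_gt0// => dr.
have pw : dotv p w0 = e ^+ 2.
  have -> : w0 = p - mu0 *: xb by rewrite addrK.
  by rewrite enorm_sqr dotvDr dotvNr dotvZr pxb mulr0 subr0.
clearbody p.
(* p' is p made orthogonal to x, which removes the dependence on mu *)
pose p' := p - dotv p x *: x.
have xx : dotv x x = 1 by rewrite -enorm_sqr x1 expr1n.
have p'p : enorm p' <= e.
  rewrite -(@ler_pXn2r _ 2)// ?nnegrE ?enorm_ge0// !enorm_sqr /p' !dotvE xx (dotvC x p).
  have := sqr_ge0 (dotv p x); lra.
have p'w : dotv p' (gq x + mu *: x)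
    = e ^+ 2 + dotv p (B *m d) - dotv p d * dotv x (gq x).
  have px : dotv p x = dotv p d by rewrite xE dotvDr pxb add0r.
  rewrite /p' !dotvE xx px {1}xE gqE dotvDr -/w0 pw; ring.
have xg : `|dotv x (gq x)| <= Q.
  apply: le_trans (cauchy_schwarz _ _) _; rewrite x1 mul1r xE gqE.
  apply: le_trans (ler_enormD _ _) _; rewrite lerD2l.
  by apply: le_trans (hB _) _; rewrite ler_piMr.
have h1 : e ^+ 2 - e * (kB * enorm d) - e * enorm d * Q <= e * enorm (gq x + mu *: x).
  have c1 : `|dotv p (B *m d)| <= e * (kB * enorm d).
    by apply: le_trans (cauchy_schwarz _ _) _; rewrite ler_wpM2l// ?ltW.
  have c2 : `|dotv p d * dotv x (gq x)| <= e * enorm d * Q.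
    by rewrite normrM ler_pM// cauchy_schwarz.
  apply: (@le_trans _ _ (dotv p' (gq x + mu *: x))).
    move: c1 c2; rewrite p'w !ler_norml; lra.
  by apply: le_trans (ler_dotv _ _) _; rewrite ler_wpM2r ?enorm_ge0.
rewrite -(ler_pM2l e0); apply: le_trans h1.
have e2 := ler_wpM2l (ltW e0) dr.
have e3 : 0 <= e * enorm d by rewrite mulr_ge0 ?enorm_ge0// ltW.
rewrite /Q2 in e2; rewrite /Q; lra.
Qed.

End QuadraticLojasiewicz.

(** * Gradients and the descent inequality *)

Section Gradient.
Context {R : realType} {n : nat}.
Implicit Types (F : 'cV[R]_n -> R) (g : 'cV[R]_n -> 'cV[R]_n) (x d : 'cV[R]_n).

(** A positive value excludes the default [0] of the supremum, so that the set of
    difference quotients is bounded. *)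
Lemma lipschitz_constP g : 0 < lipschitz_const g ->
  forall x y, enorm (g x - g y) <= lipschitz_const g * enorm (x - y).
Proof.
rewrite /lipschitz_const; set S := (X in sup X) => S0 x y.
have supS : has_sup S.
  by apply: contrapT => /sup_out S1; move: S0; rewrite S1 ltxx.
have [->|xy] := eqVneq x y; first by rewrite !subrr !enorm0 mulr0.
have xy0 : 0 < enorm (x - y) by rewrite lt_def enorm_eq0 subr_eq0 xy enorm_ge0.
rewrite -ler_pdivrMr//; apply: (ub_le_sup supS.2).
by exists (x, y).
Qed.

Section Taylor.
Variables (F : 'cV[R]_n -> R) (g : 'cV[R]_n -> 'cV[R]_n) (K : R).
Hypothesis taylor : forall x d,
  `|F (x + d) - F x - dotv (g x) d| <= K * enorm d ^+ 2.

Lemma gradient_of_taylor : gradient F = g.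
Proof.
apply/funext => x; apply/colP => i; rewrite mxE.
have e1 : enorm (delta_mx i 0 : 'cV[R]_n) = 1.
  rewrite /enorm (bigD1 i)//= mxE !eqxx expr1n big1 ?addr0 ?sqrtr1// => j ji.
  by rewrite mxE (negbTE ji) expr0n.
have gi := dotv_delta (g x) i.
have K0 : 0 <= K.
  have := taylor x (delta_mx i 0); rewrite e1 expr1n mulr1; exact: le_trans.
apply: cvg_lim => //; apply/cvgrPdist_le => e e0.
near=> h; have h0 : h != 0 by near: h; exact: nbhs_dnbhs_neq.
have := taylor x (h *: delta_mx i 0).
rewrite dotvZr gi enormZ e1 mulr1 real_normK ?num_real// => t.
rewrite (_ : _ *: _ = h^-1 * (F (x + h *: delta_mx i 0) - F x)); last first.
  by rewrite /= (addrC x).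
rewrite distrC -[g x i 0](mulKf h0) -mulrBr normrM normfV.
rewrite mulrC ler_pdivrMr ?normr_gt0//; apply: le_trans t _.
rewrite -real_normK ?num_real// expr2 mulrA ler_wpM2r//.
have : `|h| <= e / (K + 1).
  by near: h; apply: dnbhs0_le; rewrite divr_gt0// ltr_wpDl.
rewrite ler_pdivlMr; last by rewrite ltr_wpDl.
have := normr_ge0 h; lra.
Unshelve. all: by end_near. Qed.

(** Splitting a step into two halves halves the excess of the constant over
    [L / 2]. *)
Lemma descent_lemma L : 0 <= L ->
  (forall x y, enorm (g x - g y) <= L * enorm (x - y)) ->
  forall x d, `|F (x + d) - F x - dotv (g x) d| <= L / 2 * enorm d ^+ 2.
Proof.
move=> L0 lip.
have half e : (forall x d, `|F (x + d) - F x - dotv (g x) d|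
    <= (L / 2 + e) * enorm d ^+ 2) ->
  forall x d, `|F (x + d) - F x - dotv (g x) d| <= (L / 2 + e / 2) * enorm d ^+ 2.
  move=> he x d; pose u := 2^-1 *: d.
  have du : d = u + u by rewrite -scalerDl -[2^-1]mul1r -splitr scale1r.
  have nd : enorm d = 2 * enorm u.
    by rewrite enormZ normfV normr_nat mulrA divff ?mul1r// pnatr_eq0.
  have h1 := he x u; have h2 := he (x + u) u; clearbody u.
  have h3 : `|dotv (g (x + u) - g x) u| <= L * enorm u ^+ 2.
    apply: le_trans (cauchy_schwarz _ _) _; rewrite expr2 mulrA ler_wpM2r ?enorm_ge0//.
    by apply: le_trans (lip _ _) _; rewrite addrAC subrr add0r.
  rewrite nd du [x + _]addrA; move: h1 h2 h3; rewrite !dotvE !ler_norml; lra.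
have iter m : forall x d, `|F (x + d) - F x - dotv (g x) d|
    <= (L / 2 + `|K| / 2 ^+ m) * enorm d ^+ 2.
  elim: m => [|m IH].
    move=> x d; apply: le_trans (taylor x d) _; rewrite ler_wpM2r ?sqr_ge0//.
    by rewrite expr0 divr1; have := ler_norm K; lra.
  by move: (half _ IH); rewrite exprSr invfM mulrA.
move=> x d; apply/ler_addgt0Pr => e e0.
pose c := `|K| * enorm d ^+ 2; have c0 : 0 <= c by rewrite mulr_ge0 ?sqr_ge0.
have [m hm] : exists m, c / 2 ^+ m <= e.
  exists (Num.truncn (c / e)).+1; rewrite ler_pdivrMr ?exprn_gt0// mulrC.
  rewrite -ler_pdivrMr//; apply: ltW.
  have /andP[_] := truncn_itv (divr_ge0 c0 (ltW e0)).
  move=> /lt_le_trans; apply.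
  by rewrite -natrX ler_nat ltnW// ltn_expl.
by apply: le_trans (iter m x d) _; rewrite mulrDl lerD2l mulrAC.
Qed.

End Taylor.
End Gradient.

(** * Sums of squared hinges *)

Section HingeSum.
Context {R : realType} {n : nat} {J : finType}.
Variables (alpha c : J -> R) (v : J -> 'cV[R]_n).
Implicit Types (x d u w : 'cV[R]_n).

Definition hinge (t : R) : R := Num.max 0 t.

Definition hinge_sum x := \sum_j alpha j * hinge (dotv (v j) x + c j) ^+ 2.

Definition hinge_grad x :=
  \sum_j (2 * alpha j * hinge (dotv (v j) x + c j)) *: v j.

Lemma hinge_taylor s t :
  `|hinge (s + t) ^+ 2 - hinge s ^+ 2 - 2 * hinge s * t| <= t ^+ 2.
Proof.
rewrite /hinge ler_norml; apply/andP; split;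
 case: (ltrP 0 s) => hs; case: (ltrP 0 (s + t)) => hst; nra.
Qed.

Lemma dotv_suml (I : finType) (P : pred I) (f : I -> 'cV[R]_n) u :
  dotv (\sum_(i | P i) f i) u = \sum_(i | P i) dotv (f i) u.
Proof.
apply: (big_morph (fun x => dotv x u)) => [x y|]; [exact: dotvDl|exact: dotv0l].
Qed.

Lemma hinge_sum_taylor x d :
  `|hinge_sum (x + d) - hinge_sum x - dotv (hinge_grad x) d|
  <= (\sum_j `|alpha j| * enorm (v j) ^+ 2) * enorm d ^+ 2.
Proof.
rewrite /hinge_sum /hinge_grad dotv_suml -!sumrB mulr_suml.
apply: le_trans (ler_norm_sum _ _ _) _; apply: ler_sum => j _.
rewrite dotvDr dotvZl (addrAC (dotv _ x)).
set s := dotv _ x + _; set t := dotv _ d.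
rewrite (_ : _ - _ - _ =
  alpha j * (hinge (s + t) ^+ 2 - hinge s ^+ 2 - 2 * hinge s * t)); last by ring.
rewrite normrM -[leRHS]mulrA ler_wpM2l//; apply: le_trans (hinge_taylor _ _) _.
rewrite -exprMn -real_normK ?num_real// lerXn2r ?nnegrE ?mulr_ge0 ?enorm_ge0//.
exact: cauchy_schwarz.
Qed.


Lemma ler_enorm u w : (forall i, `|u i 0| <= `|w i 0|) -> enorm u <= enorm w.
Proof.
move=> h; apply: ler_wsqrtr; apply: ler_sum => i _.
by rewrite -[leLHS]real_normK ?num_real// -[leRHS]real_normK ?num_real// lerXn2r ?nnegrE.
Qed.

Lemma near_affine_pos u (a : R) x : 0 < dotv u x + a ->
  \forall y \near x, 0 < dotv u y + a.
Proof.
move=> h; have u0 : 0 < enorm u + 1 by rewrite ltr_wpDl ?enorm_ge0.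
apply/nbhs_enormP; exists ((dotv u x + a) / (enorm u + 1)); first by rewrite divr_gt0.
move=> y; rewrite ltr_pdivlMr// => hy.
have := ler_dotv u (x - y); rewrite enormB dotvDr dotvNr.
have := enorm_ge0 (y - x); lra.
Qed.

(** Composing the affine forms with the coordinate projection onto the support
    replaces a subspace of [R^n] by the whole space, without changing the values
    on that subspace. *)
Definition restrict (I : {set 'I_n}) u : 'cV[R]_n :=
  \col_i (if i \in I then u i 0 else 0).

Definition sign_vec (I N : {set 'I_n}) : 'cV[R]_n :=
  \col_i (if i \in I then if i \in N then -1 else 1 else 0).

Variable kap : R.

(** The quadratic function with which [hinge_sum + kap * norm1] agrees at the
    points of support [I] that are negative exactly on [N] and at which the hinges
    in [T] are the active ones. *)
Section Piece.
Variables (T : {set J}) (I N : {set 'I_n}).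

Definition piece x : R :=
  \sum_(j in T) alpha j * (dotv (restrict I (v j)) x + c j) ^+ 2
  + kap * dotv (sign_vec I N) x.

Definition piece_grad x : 'cV[R]_n :=
  \sum_(j in T) (2 * alpha j * (dotv (restrict I (v j)) x + c j)) *: restrict I (v j)
  + kap *: sign_vec I N.

Definition piece_hess : 'M[R]_n :=
  \sum_(j in T) (2 * alpha j) *: (restrict I (v j) *m (restrict I (v j))^T).

Lemma outer_mulmx u d : u *m u^T *m d = dotv u d *: u.
Proof.
rewrite -mulmxA; apply/colP => i; rewrite !mxE big_ord1 mulrC; congr (_ * _).
by rewrite mxE; apply: eq_bigr => j _; rewrite !mxE.
Qed.

Lemma piece_hessE d : piece_hess *m d =
  \sum_(j in T) (2 * alpha j * dotv (restrict I (v j)) d) *: restrict I (v j).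
Proof.
rewrite mulmx_suml; apply: eq_bigr => j _.
by rewrite -scalemxAl outer_mulmx scalerA.
Qed.

Lemma piece_lojasiewicz xb : enorm xb = 1 -> exists rK : R * R,
  [/\ 0 < rK.1, 0 <= rK.2 & forall x mu,
    enorm x = 1 -> enorm (x - xb) <= rK.1 ->
    `|piece x - piece xb| ^+ 3 <= rK.2 * enorm (piece_grad x + mu *: x) ^+ 4].
Proof.
move=> xb1; have [r [K h]] : exists r K, [/\ 0 < r, 0 <= K & forall x mu,
    enorm x = 1 -> enorm (x - xb) <= r ->
    `|piece x - piece xb| ^+ 3 <= K * enorm (piece_grad x + mu *: x) ^+ 4].
  apply: (@quadratic_lojasiewicz _ _ piece_hess) => //.
  - rewrite /piece_hess linear_sum; apply: eq_bigr => j _ /=.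
    by rewrite linearZ /= trmx_mul trmxK.
  - move=> x d; rewrite /piece /piece_grad piece_hessE dotvDl dotvZl dotvDr.
    rewrite dotv_suml [dotv d _]dotvC dotv_suml mulr_suml mulrDr.
    set S := \sum_(j in T) alpha j * _ ^+ 2; set Sx := \sum_(j in T) alpha j * _ ^+ 2.
    set S1 := \sum_(j in T) dotv _ d; set S2 := \sum_(j in T) _ / 2.
    have -> : S = Sx + S1 + S2.
      rewrite -!big_split; apply: eq_bigr => j _ /=.
      by rewrite dotvDr !dotvZl; field.
    by ring.
  - move=> x d; rewrite /piece_grad piece_hessE addrAC -big_split; congr (_ + _).
    by apply: eq_bigr => j _ /=; rewrite -scalerDl dotvDr; congr (_ *: _); ring.
by exists (r, K).
Qed.

End Piece.

(** The vector [w] is constrained on the support of [x] only, which is what a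
    subgradient of [hinge_sum + kap * norm1] on the sphere satisfies.  A pattern
    [T], [I], [N] realized by points near [xb] is compatible with [xb]: the
    hinges, and the coordinates, that are not zero at [xb] keep their sign, and
    the others do not contribute at [xb].  Hence the quadratic piece of [x] has
    the right value at [xb] too, and there are finitely many pieces. *)
Lemma hinge_l1_lojasiewicz xb : enorm xb = 1 -> exists r K,
  [/\ 0 < r, 0 <= K & forall x w mu, enorm x = 1 -> enorm (x - xb) < r ->
    (forall i, x i 0 != 0 ->
       w i 0 = hinge_grad x i 0 + kap * Num.sg (x i 0) + mu * x i 0) ->
    `|hinge_sum x + kap * norm1 x - (hinge_sum xb + kap * norm1 xb)| ^+ 3
      <= K * enorm w ^+ 4].
Proof.
move=> xb1.
have [rK hrK] := choice (fun P : {set J} * {set 'I_n} * {set 'I_n} =>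
  piece_lojasiewicz P.1.1 P.1.2 P.2 xb1).
have near_pieces : \forall x \near xb, forall P, enorm (x - xb) <= (rK P).1.
  apply: (@filter_forall _ _ _ (nbhs xb)) => P; have [r0 _ _] := hrK P.
  by near=> x; apply: ltW; near: x; exact: nbhs_enorm.
have near_hinges : \forall x \near xb, forall j,
    (0 < dotv (v j) xb + c j -> 0 < dotv (v j) x + c j) /\
    (dotv (v j) xb + c j < 0 -> dotv (v j) x + c j < 0).
  apply: (@filter_forall _ _ _ (nbhs xb)) => j; case: (ltrgt0P (dotv (v j) xb + c j)) => h.
  - by near=> x; split=> // _; near: x; exact: near_affine_pos.
  - have h' : 0 < dotv (- v j) xb + - c j by rewrite dotvNl -opprD oppr_gt0.
    near=> x; split=> // _; rewrite -oppr_gt0 opprD -dotvNl.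
    by near: x; exact: near_affine_pos.
  - by near=> x; split.
pose same_sign (x : 'cV[R]_n) i :=
  (0 < xb i 0 -> 0 < x i 0) /\ (xb i 0 < 0 -> x i 0 < 0).
have near_signs : \forall x \near xb, forall i, same_sign x i.
  have coordE i (x : 'cV[R]_n) : x i 0 = dotv (delta_mx i 0) x + 0.
    by rewrite addr0 dotvC dotv_delta.
  apply: (@filter_forall _ _ _ (nbhs xb)) => i; rewrite /same_sign; case: (ltrgt0P (xb i 0)) => h.
  - have h' := h; rewrite coordE in h'; near=> x; split=> // _; rewrite coordE.
    by near: x; exact: near_affine_pos.
  - have h' : 0 < dotv (- delta_mx i 0) xb + 0.
      by rewrite addr0 dotvNl oppr_gt0 -[dotv _ _]addr0 -coordE.
    near=> x; split=> // _; rewrite coordE addr0 -oppr_gt0 -dotvNl -[ltRHS]addr0.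
    by near: x; exact: near_affine_pos.
  - by near=> x; split.
have [r r0 hr] := (nbhs_enormP _ _).1
  (filterI near_pieces (filterI near_hinges near_signs)).
exists r, (\sum_P (rK P).2); split=> //.
  by apply: sumr_ge0 => P _; have [] := hrK P.
move=> x w mu x1 xr hw; have [hp [hh hs]] := hr x xr.
pose T := [set j | 0 < dotv (v j) x + c j]%SET.
pose I := [set i | x i 0 != 0]%SET; pose N := [set i | x i 0 < 0]%SET.
have xb_supp i : x i 0 = 0 -> xb i 0 = 0.
  move=> xi; apply/le_anti; rewrite !leNgt; apply/andP; split.
    by apply/negP => /(hs i).1; rewrite xi ltxx.
  by apply/negP => /(hs i).2; rewrite xi ltxx.
have dotv_restrict u (y : 'cV[R]_n) : (forall i, x i 0 = 0 -> y i 0 = 0) ->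
    dotv (restrict I u) y = dotv u y.
  move=> hy; apply: eq_bigr => i _; rewrite mxE inE.
  by have [/hy ->|//] := eqVneq (x i 0) 0; rewrite !mulr0.
have pieceE (y : 'cV[R]_n) : (forall i, x i 0 = 0 -> y i 0 = 0) ->
    (forall i, 0 < x i 0 -> 0 <= y i 0) -> (forall i, x i 0 < 0 -> y i 0 <= 0) ->
    (forall j, 0 < dotv (v j) x + c j -> 0 <= dotv (v j) y + c j) ->
    (forall j, dotv (v j) x + c j <= 0 -> dotv (v j) y + c j <= 0) ->
    piece T I N y = hinge_sum y + kap * norm1 y.
  move=> hy hpos hneg h1 h2; congr (_ + _ * _).
    rewrite [RHS](bigID (fun j => j \in T))/= [X in _ = _ + X]big1 ?addr0.
      apply: eq_bigr => j; rewrite inE => /h1 yj; rewrite dotv_restrict//.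
      by rewrite /hinge max_r.
    move=> j; rewrite inE -leNgt => /h2 yj.
    by rewrite /hinge max_l// expr0n mulr0.
  apply: eq_bigr => i _; rewrite mxE !inE; case: (ltrgt0P (x i 0)) => xi /=.
  - by rewrite mul1r ger0_norm ?hpos.
  - by rewrite mulN1r ler0_norm ?hneg.
  - by rewrite mul0r hy// normr0.
have Fx : piece T I N x = hinge_sum x + kap * norm1 x.
  by apply: pieceE => // i; exact: ltW.
have Fxb : piece T I N xb = hinge_sum xb + kap * norm1 xb.
  apply: pieceE => //.
  - move=> i xi; rewrite leNgt; apply/negP => /(hs i).2 h.
    by have := lt_trans xi h; rewrite ltxx.
  - move=> i xi; rewrite leNgt; apply/negP => /(hs i).1 h.
    by have := lt_trans xi h; rewrite ltxx.
  - move=> j xj; rewrite leNgt; apply/negP => /(hh j).2 h.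
    by have := lt_trans xj h; rewrite ltxx.
  - move=> j xj; rewrite leNgt; apply/negP => /(hh j).1 h.
    by have := le_lt_trans xj h; rewrite ltxx.
have grad_le : enorm (piece_grad T I N x + mu *: x) <= enorm w.
  apply: ler_enorm => i; have [xi|xi] := eqVneq (x i 0) 0.
    rewrite (_ : _ i 0 = 0) ?normr0// !mxE summxE big1 => [|j _].
      by rewrite inE xi eqxx /= !mulr0 !addr0.
    by rewrite !mxE inE xi eqxx /= mulr0.
  rewrite hw// le_eqVlt; apply/orP; left; apply/eqP; congr (`| _ |).
  rewrite !mxE !inE xi /=; congr (_ + _ * _ + _); last first.
    by case: (ltrgt0P (x i 0)) xi => //= h _; rewrite ?(gtr0_sg h) ?(ltr0_sg h).
  rewrite /hinge_grad !summxE [RHS](bigID (fun j => j \in T))/=.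
  rewrite [X in _ = _ + X]big1 ?addr0.
    apply: eq_bigr => j; rewrite inE => xj; rewrite !mxE inE xi dotv_restrict//.
    by rewrite /hinge max_r// ltW.
  by move=> j; rewrite inE -leNgt => xj; rewrite /hinge max_l// mulr0 mxE mul0r.
have [_ K0 /(_ x mu x1 (hp _))] := hrK (T, I, N); rewrite /= Fx Fxb => h.
apply: le_trans h _; apply: ler_pM; rewrite ?exprn_ge0 ?enorm_ge0//.
  rewrite (bigD1 (T, I, N))//= lerDl; apply: sumr_ge0 => P _.
  by have [] := hrK P.
by rewrite lerXn2r ?nnegrE ?enorm_ge0.
Unshelve. all: by end_near. Qed.

End HingeSum.

Section ConcreteLoss.
Context {R : realType}.

(** The second derivative of [vartheta sigma gamma] jumps at [0], [- gamma],
    [gamma - sigma] and [- (sigma + gamma)], and is constant in between. *)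
Lemma vartheta_hinge (sigma gamma t : R) : 0 < gamma < sigma / 2 ->
  vartheta sigma gamma t
  = (2 * gamma)^-1 * (hinge (- t) ^+ 2 - hinge (- t - gamma) ^+ 2)
    - (4 * gamma)^-1 * (hinge (- t - (sigma - gamma)) ^+ 2
                        - hinge (- t - (sigma + gamma)) ^+ 2).
Proof.
move=> /andP[g0 gs]; have gn0 : gamma != 0 by rewrite gt_eqF.
rewrite /vartheta /hinge; case: ifPn => [t0|]; last rewrite -leNgt => t0.
  by rewrite !max_l ?expr0n /= ?subrr ?mulr0 ?subr0//; lra.
rewrite [Num.max 0 (- t)]max_r; last lra.
case: ifPn => [t1|]; last rewrite -leNgt => t1.
  by rewrite !max_l ?expr0n /=; [field|lra|lra|lra].
rewrite [Num.max 0 (- t - gamma)]max_r; last lra.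
case: ifPn => [t2|]; last rewrite -leNgt => t2.
  by rewrite !max_l ?expr0n /=; [field|lra|lra].
rewrite [Num.max 0 (- t - (sigma - gamma))]max_r; last lra.
case: ifPn => [t3|]; last rewrite -ltNge => t3.
  by rewrite !max_l ?expr0n /=; [field|lra].
by rewrite max_r; [field|lra].
Qed.

Lemma psi_star_hinge (a w : R) : 1 < a ->
  psi_star a w = (a + 1) / (4 * (a - 1)) *
    (hinge (w - 2 / (a + 1)) ^+ 2 - hinge (w - 2 * a / (a + 1)) ^+ 2).
Proof.
move=> a1; have a1n : a + 1 != 0 by rewrite gt_eqF//; lra.
have a2n : a - 1 != 0 by rewrite gt_eqF//; lra.
have a3n : a ^+ 2 - 1 != 0 by rewrite gt_eqF//; nra.
have pq : 2 / (a + 1) <= 2 * a / (a + 1).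
  by rewrite ler_pM2r ?invr_gt0; lra.
rewrite /psi_star /hinge; case: ifPn => [w0|]; last rewrite -ltNge => w0.
  by rewrite !max_l ?expr0n /= ?subrr ?mulr0//; lra.
rewrite [Num.max 0 (w - 2 / (a + 1))]max_r; last lra.
case: ifPn => [w1|]; last rewrite -ltNge => w1.
  by rewrite max_l ?expr0n /=; [field; rewrite a1n a2n a3n|lra].
by rewrite max_r; [field; rewrite a1n a2n|lra].
Qed.

(** At most one of the two hinges on the right is active, because [p >= 0]. *)
Lemma hinge_norm (r t p : R) : 0 <= r -> 0 <= p ->
  hinge (r * `|t| - p) ^+ 2 = hinge (r * t - p) ^+ 2 + hinge (- r * t - p) ^+ 2.
Proof.
move=> r0 p0; rewrite /hinge; case: (ler0P t) => t0.
  rewrite [Num.max 0 (r * t - p)]max_l ?expr0n ?add0r /=; last by nra.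
  by rewrite mulrN mulNr.
by rewrite [Num.max 0 (- r * t - p)]max_l ?expr0n ?addr0 //=; nra.
Qed.

Section Closure.
Context {n : nat}.
Implicit Types (F : 'cV[R]_n -> R).

Definition is_hinge_sum F := exists (J : finType) (alpha c : J -> R)
  (v : J -> 'cV[R]_n), forall x, F x = hinge_sum alpha c v x.

Lemma is_hinge_sum_hinge (al c : R) v :
  is_hinge_sum (fun x => al * hinge (dotv v x + c) ^+ 2).
Proof.
by exists unit, (fun=> al), (fun=> c), (fun=> v) => x; rewrite /hinge_sum big_const card_unit /= addr0.
Qed.

Lemma is_hinge_sumD F1 F2 : is_hinge_sum F1 -> is_hinge_sum F2 ->
  is_hinge_sum (fun x => F1 x + F2 x).
Proof.
move=> [J1 [a1 [c1 [v1 h1]]]] [J2 [a2 [c2 [v2 h2]]]].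
exists (J1 + J2)%type, (fun j => match j with inl j => a1 j | inr j => a2 j end),
  (fun j => match j with inl j => c1 j | inr j => c2 j end),
  (fun j => match j with inl j => v1 j | inr j => v2 j end) => x.
by rewrite h1 h2 /hinge_sum big_sumType.
Qed.

Lemma is_hinge_sum_sum (I : finType) (F : I -> 'cV[R]_n -> R) :
  (forall i, is_hinge_sum (F i)) -> is_hinge_sum (fun x => \sum_i F i x).
Proof.
move=> hF; elim: (index_enum I) => [|i s IH].
  exists void, (fun=> 0), (fun=> 0), (fun=> 0) => x.
  by rewrite big_nil /hinge_sum big1// => -[].
have [J [a [c [v h]]]] := is_hinge_sumD (hF i) IH.
by exists J, a, c, v => x; rewrite big_cons h.
Qed.

End Closure.

Lemma Xi_is_hinge_sum m n (A : 'M[R]_(m, n)) (lambda rho a sigma gamma : R) :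
  0 < rho -> 1 < a -> 0 < gamma < sigma / 2 ->
  is_hinge_sum (Xi A lambda rho a sigma gamma).
Proof.
move=> rho0 a1 hg; pose g (al c : R) (v : 'cV[R]_n) x := al * hinge (dotv v x + c) ^+ 2.
have hloss : is_hinge_sum (fun x => \sum_i vartheta sigma gamma ((A *m x) i 0)).
  apply: is_hinge_sum_sum => i; pose v := - (row i A)^T.
  have [J [al [c [w h]]]] := is_hinge_sumD
    (is_hinge_sumD (is_hinge_sum_hinge (2 * gamma)^-1 0 v)
                   (is_hinge_sum_hinge (- (2 * gamma)^-1) (- gamma) v))
    (is_hinge_sumD (is_hinge_sum_hinge (- (4 * gamma)^-1) (- (sigma - gamma)) v)
                   (is_hinge_sum_hinge (4 * gamma)^-1 (- (sigma + gamma)) v)).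
  exists J, al, c, w => x; rewrite -h vartheta_hinge//.
  have -> : (A *m x) i 0 = - dotv v x.
    by rewrite /v dotvNl opprK mxE; apply: eq_bigr => j _; rewrite !mxE.
  by rewrite opprK addr0; ring.
have hpen : is_hinge_sum (fun x : 'cV[R]_n =>
    \sum_i (- lambda * psi_star a (rho * `|x i 0|))).
  apply: is_hinge_sum_sum => i.
  pose k := lambda * ((a + 1) / (4 * (a - 1))).
  pose p := 2 / (a + 1); pose q := 2 * a / (a + 1).
  pose v : 'cV[R]_n := rho *: delta_mx i 0.
  have [J [al [c [w h]]]] := is_hinge_sumD
    (is_hinge_sumD (is_hinge_sum_hinge (- k) (- p) v)
                   (is_hinge_sum_hinge (- k) (- p) (- v)))
    (is_hinge_sumD (is_hinge_sum_hinge k (- q) v)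
                   (is_hinge_sum_hinge k (- q) (- v))).
  exists J, al, c, w => x; rewrite -h psi_star_hinge//.
  have p0 : 0 <= p by rewrite divr_ge0//; lra.
  have q0 : 0 <= q by rewrite divr_ge0//; lra.
  rewrite -/p -/q !(hinge_norm _ (ltW rho0)) // !dotvNl.
  have -> : dotv v x = rho * x i 0.
    by rewrite dotvZl dotvC dotv_delta.
  by rewrite -/p -/q -(mulNr rho) /k; ring.
have [J [al [c [w h]]]] := is_hinge_sumD hloss hpen.
exists J, al, c, w => x; rewrite -h /Xi /f_loss mulr_sumr -sumrN.
by congr (_ + _); apply: eq_bigr => i _; rewrite mulNr.
Qed.

End ConcreteLoss.

(** * Proximal steps on the sphere *)

Section Prox.
Context {R : realType} {n : nat}.
Implicit Types (u w x z xb : 'cV[R]_n) (h : 'cV[R]_n -> \bar R).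

(** The proximal condition for [h_reg], where only points of the sphere have a
    finite value. *)
Definition sphere_prox (tau kap : R) u x := enorm x = 1 /\
  forall z, enorm z = 1 -> (2 * tau)^-1 * enorm (x - u) ^+ 2 + kap * norm1 x
                        <= (2 * tau)^-1 * enorm (z - u) ^+ 2 + kap * norm1 z.

Lemma h_reg_sphere (lambda rho : R) x : enorm x = 1 ->
  h_reg lambda rho x = (lambda * rho * norm1 x)%:E.
Proof. by move=> x1; rewrite /h_reg /indicator mem_set// add0e. Qed.

Lemma h_reg_off (lambda rho : R) x : enorm x <> 1 -> h_reg lambda rho x = +oo%E.
Proof. by move=> x1; rewrite /h_reg /indicator memNset. Qed.

Lemma prox_h_regP (tau lambda rho : R) u x x0 : enorm x0 = 1 ->
  prox tau (h_reg lambda rho) u x <-> sphere_prox tau (lambda * rho) u x.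
Proof.
move=> x01; rewrite /prox /argmin /= div1r; split.
  move=> hx; have x1 : enorm x = 1.
    apply: contrapT => x1; have := hx x0.
    by rewrite (h_reg_off _ _ x1) (h_reg_sphere _ _ x01) addey// -EFinD leye_eq.
  split=> // z z1; have := hx z.
  by rewrite !h_reg_sphere// -!EFinD lee_fin.
move=> [x1 hx] z; have [z1|z1] := pselect (enorm z = 1).
  by rewrite !h_reg_sphere// -!EFinD lee_fin; exact: hx.
by rewrite (h_reg_off _ _ z1) addey// leey.
Qed.

Variables (tau kap : R).
Hypothesis tau0 : 0 < tau.

Lemma sphere_prox_le u x z : sphere_prox tau kap u x -> enorm z = 1 ->
  kap * norm1 x + dotv (tau^-1 *: (u - x)) (z - x)
    - (2 * tau)^-1 * enorm (z - x) ^+ 2 <= kap * norm1 z.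
Proof.
move=> [x1 hx] z1; have := hx z z1.
have -> : tau^-1 = 2 * (2 * tau)^-1 by field; rewrite gt_eqF.
set c := (2 * tau)^-1; rewrite !enorm_sqr !dotvE.
by rewrite (dotvC u x) (dotvC z x) (dotvC u z); lra.
Qed.

(** The penalized objective is positively homogeneous up to terms that are
    constant on the sphere, so its minimality over the sphere bounds a
    homogeneous function on the whole space and each coordinate along which
    [x] does not vanish can be varied freely. *)
Lemma sphere_prox_multiplier u x : sphere_prox tau kap u x -> exists mu,
  forall i, x i 0 != 0 ->
    (tau^-1 *: (u - x)) i 0 = kap * Num.sg (x i 0) + mu * x i 0.
Proof.
move=> [x1 hx]; pose v := tau^-1 *: u.
pose F z := dotv v z - kap * norm1 z; pose M := F x.
have tau2 : 0 < (2 * tau)^-1 by rewrite invr_gt0 mulr_gt0.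
have Fsphere z : enorm z = 1 -> F z <= M.
  move=> z1; have := hx z z1; rewrite !enorm_sqr !dotvE -!enorm_sqr x1 z1.
  rewrite /M /F /v !dotvZl (dotvC u x) (dotvC u z).
  have -> : tau^-1 = 2 * (2 * tau)^-1 by field; rewrite gt_eqF.
  by set c := (2 * tau)^-1; rewrite !expr1n; lra.
have FM z : F z <= M * enorm z.
  have [->|z0] := eqVneq z 0.
    rewrite enorm0 mulr0 /F dotvC dotv0l sub0r oppr_le0.
    by rewrite /norm1 big1 ?mulr0// => i _; rewrite mxE normr0.
  have e0 : 0 < enorm z by rewrite lt_def enorm_eq0 z0 enorm_ge0.
  have := Fsphere ((enorm z)^-1 *: z); rewrite enormZ gtr0_norm ?invr_gt0//.
  rewrite mulVf ?gt_eqF// => /(_ erefl).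
  move=> /(ler_wpM2l (ltW e0)); rewrite (mulrC M) => h; apply: le_trans h.
  have -> : F z = enorm z * F ((enorm z)^-1 *: z); last by [].
  have -> : F ((enorm z)^-1 *: z) = (enorm z)^-1 * F z.
    rewrite /F dotvZr mulrBr (mulrCA _ kap); congr (_ - _ * _).
    rewrite /norm1 mulr_sumr; apply: eq_bigr => j _.
    by rewrite mxE normrM gtr0_norm ?invr_gt0.
  by rewrite mulrA divff ?gt_eqF// mul1r.
exists (M - tau^-1) => i xi.
suff : v i 0 - kap * Num.sg (x i 0) - M * x i 0 = 0.
  by rewrite /v !mxE; lra.
set b := v i 0 - _ - _; apply/eqP; apply: contraT => b0.
have bp : 0 < `|b| by rewrite normr_gt0.
have xip : 0 < `|x i 0| by rewrite normr_gt0.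
have xi1 : `|x i 0| <= 1 by rewrite -x1 ler_coord.
(* t is too small to change the sign of x i 0, so the l1 norm is affine in t *)
have key t : `|t| <= 2^-1 -> `|t| < `|x i 0| -> t * b <= `|M| * t ^+ 2.
  move=> t1 t2; pose z := x + t *: delta_mx i 0.
  have zi j : z j 0 = x j 0 + (if j == i then t else 0).
    by rewrite !mxE eqxx andbT; case: eqP => _; rewrite ?mulr1 ?mulr0.
  have dvz : dotv v z = dotv v x + t * v i 0.
    by rewrite dotvDr dotvZr dotv_delta.
  have n1z : norm1 z = norm1 x + t * Num.sg (x i 0).
    rewrite /norm1 (bigD1 i)//= [in RHS](bigD1 i)//= zi eqxx addrAC; congr (_ + _).
      have /orP[h|h] := lt_total xi; move: t2; rewrite ltr_norml.
        by rewrite (ltr0_norm h) (ltr0_sg h) => /andP[t2 t3]; rewrite ltr0_norm; lra.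
      by rewrite (gtr0_norm h) (gtr0_sg h) => /andP[t2 t3]; rewrite gtr0_norm; lra.
    by apply: eq_bigr => j ji; rewrite zi (negbTE ji) addr0.
  have ez : enorm z ^+ 2 = 1 + 2 * (t * x i 0) + t ^+ 2.
    rewrite enorm_sqr /z !dotvE !dotv_delta (dotvC (delta_mx i 0)) dotv_delta.
    by rewrite -(enorm_sqr x) x1 mxE !eqxx /=; ring.
  have := FM z; rewrite /F dvz n1z.
  have tx : `|t * x i 0| <= 2^-1 by rewrite normrM -[leRHS]mulr1 ler_pM.
  have q0 := enorm_ge0 z; move: tx; rewrite ler_norml => /andP[tx _].
  set q := enorm z in ez q0 *; set y := t * x i 0 in ez tx *.
  have xi2 : x i 0 ^+ 2 <= 1.
    by rewrite -real_normK ?num_real// expr_le1.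
  have y2 : y ^+ 2 <= t ^+ 2.
    by rewrite /y exprMn ler_piMr ?sqr_ge0.
  have qy : 1 + y <= q.
    rewrite -(@ler_pXn2r _ 2)// ?nnegrE//; last by lra.
    by rewrite ez; have := y2; lra.
  have qy2 : q - 1 - y <= t ^+ 2.
    have e1 : (q - (1 + y)) * (q + (1 + y)) <= t ^+ 2.
      by rewrite -subr_sqr ez; have := sqr_ge0 y; lra.
    have e2 : (q - (1 + y)) * 1 <= (q - (1 + y)) * (q + (1 + y)).
      by apply: ler_wpM2l; lra.
    lra.
  have e3 : M * (q - 1 - y) <= `|M| * t ^+ 2.
    apply: (@le_trans _ _ (`|M| * (q - 1 - y))).
      by apply: ler_wpM2r; [lra|exact: ler_norm].
    by apply: ler_wpM2l.
  have -> : t * b = t * v i 0 - kap * (t * Num.sg (x i 0)) - M * y.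
    by rewrite /b /y; ring.
  have -> : dotv v x + t * v i 0 - kap * (norm1 x + t * Num.sg (x i 0))
     = M + (t * v i 0 - kap * (t * Num.sg (x i 0))) by rewrite /M /F; ring.
  lra.
(* for this eps the variation t = eps * b contradicts key unless b = 0 *)
pose eps := `|x i 0| / (2 * (1 + `|b|) * (1 + `|M|)).
have den : 0 < 2 * (1 + `|b|) * (1 + `|M|).
  by rewrite !mulr_gt0// ltr_pwDl.
have eps0 : 0 < eps by rewrite divr_gt0.
have bn : 1 + `|b| != 0 by rewrite gt_eqF// ltr_pwDl.
have Mn : 1 + `|M| != 0 by rewrite gt_eqF// ltr_pwDl.
have epsE : eps * (1 + `|b|) * (1 + `|M|) = `|x i 0| / 2.
  by rewrite /eps; field; rewrite bn Mn.
have M0 := normr_ge0 M.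
have epsb : 0 <= eps * `|b| by rewrite mulr_ge0// ltW.
have epsM : 0 <= eps * `|M| by rewrite mulr_ge0// ltW.
have epsbM : 0 <= eps * `|b| * `|M| by rewrite mulr_ge0.
have teps : `|eps * b| = eps * `|b| by rewrite normrM (gtr0_norm eps0).
have s1 : `|eps * b| <= 2^-1 by rewrite teps; lra.
have s2 : `|eps * b| < `|x i 0| by rewrite teps; lra.
have h := key _ s1 s2.
have b2 : 0 < b ^+ 2 by rewrite lt_def sqrf_eq0 b0 sqr_ge0.
have : 1 <= `|M| * eps.
  by rewrite -(ler_pM2r b2) -(ler_pM2l eps0); lra.
lra.
Qed.

End Prox.

Section Subdifferential.
Context {R : realType} {n : nat}.
Implicit Types (w x z xb : 'cV[R]_n) (h : 'cV[R]_n -> \bar R).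

(** A quadratic minorant is a regular subgradient inequality, as
    [C * |z - x| <= e] near [x]. *)
Lemma proximal_regular_subdiff h x (hx C : R) w : h x = hx%:E ->
  (forall z, ((hx + dotv w (z - x) - C * enorm (z - x) ^+ 2)%:E <= h z)%E) ->
  regular_subdiff h x w.
Proof.
move=> hxE hz; split; first by rewrite hxE.
move=> e e0; have C0 : 0 < `|C| + 1 by rewrite ltr_wpDl.
near=> z; apply: le_trans (hz z); rewrite hxE -EFinD lee_fin -addrA lerD2l lerD2l lerN2.
rewrite expr2 mulrA; apply: ler_wpM2r; first exact: enorm_ge0.
apply: (@le_trans _ _ ((`|C| + 1) * enorm (z - x))).
  apply: ler_wpM2r; first exact: enorm_ge0.
  by have := ler_norm C; lra.
rewrite mulrC -ler_pdivlMr//; apply: ltW; near: z.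
by apply: nbhs_enorm; rewrite divr_gt0.
Unshelve. all: by end_near. Qed.

Lemma regular_limiting h x w : regular_subdiff h x w -> limiting_subdiff h x w.
Proof.
move=> hw; split; first by case: hw.
by exists (fun=> x), (fun=> w); split => //; exact: cvg_cst.
Qed.

(** With [phi t = c * t ^ (1/2)], the KL inequality reads
    [c / 2 * |w| >= (h x - h xb) ^ (1/2)] for every subgradient [w]. *)
Lemma KL_half_growth h xb (hb : R) : h xb = hb%:E -> KL_at h (1 / 2) xb ->
  exists r eta c, [/\ 0 < r, 0 < eta, 0 < c & forall x (hx : R) w,
    h x = hx%:E -> enorm (x - xb) < r -> hb < hx -> hx < hb + eta ->
    limiting_subdiff h x w -> hx - hb <= c * enorm w ^+ 2].
Proof.
move=> hbE [eta [U [c [eta0 /nbhs_enormP[r r0 rU] c0 hKL]]]].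
have [e e0 eeta] : exists2 e : R, 0 < e & (e%:E <= eta)%E.
  case: eta eta0 {hKL} => [e e0|_|//]; first by exists e.
  by exists 1; rewrite ?leey.
exists r, e, (c ^+ 2 / 4); split => //; first by rewrite divr_gt0// exprn_gt0.
move=> x hx w hxE xr lt1 lt2 hw; have t0 : 0 < hx - hb by rewrite subr_gt0.
have := hKL x (rU _ xr); rewrite hxE hbE -EFinB /= !lte_fin => /(_ lt1).
have lt3 : (hx%:E < hb%:E + eta)%E.
  by apply: (@lt_le_trans _ _ (hb%:E + e%:E)%E); rewrite ?lte_fin// leeD2l.
move=> /(_ lt3).
have -> : derive1 (fun t : R => c * t `^ (1 - 1 / 2)) (hx - hb)
    = c / 2 * (Num.sqrt (hx - hb))^-1.
  rewrite derive1E; have d := is_derive1_powR (1 - 1 / 2) t0.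
  rewrite deriveZ//= derive_val.
  have -> : 1 - 1 / 2 - 1 = - 2^-1 :> R by field.
  rewrite powRN powR12_sqrt; last exact: ltW.
  rewrite /GRing.scale/= (_ : 1 - 1 / 2 = 2^-1) ?mulrA//; by field.
set s := Num.sqrt _; have s0 : 0 < s by rewrite sqrtr_gt0.
have s2 : s ^+ 2 = hx - hb by rewrite sqr_sqrtr// ltW.
have D0 : 0 <= c / 2 * s^-1 by rewrite mulr_ge0 ?invr_ge0 ?ltW// divr_gt0.
have dw : (dist0 (limiting_subdiff h x) <= (enorm w)%:E)%E.
  by apply: ereal_inf_lbound; exists w.
move=> /le_trans/(_ (lee_wpmul2l _ dw)); rewrite lee_fin -EFinM lee_fin => /(_ D0) h1.
have h2 : s <= c / 2 * enorm w.
  by move: h1; rewrite mulrAC ler_pdivlMr// mul1r.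
rewrite -s2; apply: (@le_trans _ _ ((c / 2 * enorm w) ^+ 2)).
  by rewrite lerXn2r ?nnegrE ?mulr_ge0 ?enorm_ge0 ?divr_ge0// ltW.
by rewrite le_eqVlt; apply/orP; left; apply/eqP; field.
Qed.

End Subdifferential.

(** * Convergence of inertial descent *)

Section ScalarStep.
Context {R : realType}.
Implicit Types (a b s p K M delta : R).

Lemma half_step_of_sqr s s' d : 0 <= s -> 0 <= d ->
  s' ^+ 2 <= s * d -> 2 * s' <= s + d.
Proof.
move=> s0 d0 h; have [s'0|s'0] := ltP s' 0; first by lra.
rewrite -(@ler_pXn2r _ 2)// ?nnegrE ?mulr_ge0 ?addr_ge0//.
have := sqr_ge0 (s - d); lra.
Qed.

(** By the inequality between the arithmetic and geometric means,
    [s' ^+ 2 <= s * (4 M / delta * (p - p'))] bounds [2 s'] by the sum of the two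
    factors. *)
Lemma potential_step a b s s' p p' M delta : 0 < delta -> 0 <= M -> 0 <= s ->
  p' <= p -> a - b <= 4 * M * s * (p - p') -> delta * s' ^+ 2 <= a - b ->
  s' + 4 * M / delta * p' + s' <= s + 4 * M / delta * p.
Proof.
move=> d0 M0 s0 pp h1 h2.
have : 2 * s' <= s + 4 * M / delta * (p - p').
  apply: half_step_of_sqr => //.
    by rewrite mulr_ge0 ?subr_ge0// divr_ge0 ?mulr_ge0// ltW.
  rewrite -(ler_pM2l d0); apply: le_trans (le_trans h2 h1) _.
  by rewrite le_eqVlt; apply/orP; left; apply/eqP; field; rewrite gt_eqF.
lra.
Qed.

Lemma sqrt_step a b s s' K delta : 0 < delta -> 0 <= K -> 0 <= s ->
  0 <= b -> b <= a -> a <= K * s ^+ 2 -> delta * s' ^+ 2 <= a - b ->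
  s' + 4 * (1 + K) / delta * Num.sqrt b + s'
  <= s + 4 * (1 + K) / delta * Num.sqrt a.
Proof.
move=> d0 K0 s0 b0 ba aK h; have a0 := le_trans b0 ba.
apply: potential_step h => //; first by rewrite addr_ge0.
  exact: ler_wsqrtr.
have pa : Num.sqrt a <= (1 + K) * s.
  rewrite -(@ler_pXn2r _ 2)// ?nnegrE ?sqrtr_ge0 ?mulr_ge0 ?addr_ge0//.
  rewrite sqr_sqrtr//; apply: le_trans aK _; rewrite exprMn.
  by rewrite ler_wpM2r ?sqr_ge0//; nra.
have p0 := sqrtr_ge0 a; have q0 := sqrtr_ge0 b.
have pq : Num.sqrt b <= Num.sqrt a by exact: ler_wsqrtr.
have e : a - b = (Num.sqrt a - Num.sqrt b) * (Num.sqrt a + Num.sqrt b).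
  by rewrite -subr_sqr !sqr_sqrtr.
rewrite e; move: pa p0 q0 pq; set p := Num.sqrt a; set q := Num.sqrt b.
move=> pa p0 q0 pq.
have : (p - q) * (p + q) <= (p - q) * (4 * ((1 + K) * s)).
  by apply: ler_wpM2l; lra.
lra.
Qed.

(** For the fourth roots, [a - b] is at most [4 p ^+ 3 (p - p')], and the bound on
    [a ^+ 3] says that [p ^+ 3 <= (1 + K) s]: no division by [p] occurs, and [a = 0] is covered. *)
Lemma sqrt_sqrt_step a b s s' K delta : 0 < delta -> 0 <= K -> 0 <= s ->
  0 <= b -> b <= a -> a ^+ 3 <= K * s ^+ 4 -> delta * s' ^+ 2 <= a - b ->
  s' + 4 * (1 + K) / delta * Num.sqrt (Num.sqrt b) + s'
  <= s + 4 * (1 + K) / delta * Num.sqrt (Num.sqrt a).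
Proof.
move=> d0 K0 s0 b0 ba aK h; have a0 := le_trans b0 ba.
have p0 := sqrtr_ge0 (Num.sqrt a); have q0 := sqrtr_ge0 (Num.sqrt b).
have pq : Num.sqrt (Num.sqrt b) <= Num.sqrt (Num.sqrt a) by do 2 apply: ler_wsqrtr.
apply: potential_step h => //; first by rewrite addr_ge0.
have p4 (u : R) : 0 <= u -> Num.sqrt (Num.sqrt u) ^+ 4 = u.
  by move=> u0; rewrite (exprM _ 2 2) !sqr_sqrtr ?sqrtr_ge0.
move: p0 q0 pq (p4 a a0) (p4 b b0).
set p := Num.sqrt (Num.sqrt a); set q := Num.sqrt (Num.sqrt b).
move=> p0 q0 pq pa qb.
have p3 : p ^+ 3 <= (1 + K) * s.
  rewrite -(@ler_pXn2r _ 4)// ?nnegrE ?exprn_ge0 ?mulr_ge0 ?addr_ge0//.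
  rewrite -exprM mulnC exprM pa; apply: le_trans aK _; rewrite exprMn.
  rewrite ler_wpM2r ?exprn_ge0//.
  have := exprn_ge0 2 K0; have := exprn_ge0 3 K0; have := exprn_ge0 4 K0; lra.
have e : a - b = (p - q) * ((p + q) * (p ^+ 2 + q ^+ 2)) by rewrite -pa -qb; ring.
have q2 : q ^+ 2 <= p ^+ 2 by rewrite lerXn2r.
have h4 : (p + q) * (p ^+ 2 + q ^+ 2) <= (2 * p) * (2 * p ^+ 2).
  by apply: ler_pM; rewrite ?addr_ge0 ?sqr_ge0//; lra.
have : (p - q) * ((p + q) * (p ^+ 2 + q ^+ 2)) <= (p - q) * (4 * ((1 + K) * s)).
  apply: ler_wpM2l; first by lra.
  by apply: le_trans h4 _; lra.
rewrite e; lra.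
Qed.

(** The gaps are small once [E] is close to its infimum. *)
Lemma nonincreasing_gap (E : nat -> R) : (forall k, 0 <= E k) ->
  (forall k, E k.+1 <= E k) ->
  forall e, 0 < e -> exists N, forall k, (N <= k)%N -> E k - E k.+1 < e.
Proof.
move=> E0 Edec e e0; pose S := range E.
have infS : has_inf S.
  by split; [exists (E 0%N), 0%N|exists 0 => _ [k _ <-]].
have [_ [N _ <-] hN] := inf_adherent e0 infS; exists N => k Nk.
have : E k <= E N by exact: ((nonincreasing_seqP E).1 Edec).
have : inf S <= E k.+1 by apply: (ge_inf infS.2); exists k.+1.
lra.
Qed.

End ScalarStep.

Section Trap.
Context {R : realType} {n : nat} (x : nat -> 'cV[R]_n) (xb : 'cV[R]_n) (W : nat -> R).
Hypothesis W0 : forall k, 0 <= W k.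

Lemma travel_le_potential N :
  (forall k, (N <= k)%N -> W k.+1 + enorm (x k.+1 - x k) <= W k) ->
  forall k j, (N <= k)%N -> enorm (x (k + j)%N - x k) + W (k + j)%N <= W k.
Proof.
move=> step k j Nk; elim: j => [|j IH]; first by rewrite addn0 subrr enorm0 add0r.
rewrite addnS; have := step (k + j)%N (leq_trans Nk (leq_addr _ _)).
have := ler_enorm_dist (x (k + j).+1) (x (k + j)%N) (x k); lra.
Qed.

(** The quantity [enorm (x k - xb) + W k] does not increase while [x k] is within
    [r] of [xb].  Once below [r] it remains so, and the same holds for
    every smaller threshold, which gives convergence. *)
Lemma trapped_near_cluster r N0 : 0 < r ->
  (forall k, (N0 <= k)%N -> enorm (x k - xb) < r ->
     W k.+1 + enorm (x k.+1 - x k) <= W k) ->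
  (forall e N, 0 < e -> exists2 k, (N <= k)%N & enorm (x k - xb) + W k < e) ->
  exists N, (forall k, (N <= k)%N -> W k.+1 + enorm (x k.+1 - x k) <= W k) /\
  forall e, 0 < e -> exists N', forall k, (N' <= k)%N -> enorm (x k - xb) < e.
Proof.
move=> r0 step cl.
have stay e N : e <= r -> (N0 <= N)%N -> enorm (x N - xb) + W N < e ->
    forall k, (N <= k)%N -> enorm (x k - xb) + W k < e.
  move=> er NN hN k; elim: k => [|k IH].
      by rewrite leqn0 => /eqP NE; rewrite NE in hN.
  rewrite leq_eqVlt => /predU1P[<-//|Nk]; have hk := IH Nk.
  have kr : enorm (x k - xb) < r by have := W0 k; lra.
  have := step k (leq_trans NN Nk) kr.
  have := ler_enorm_dist (x k.+1) (x k) xb; lra.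
have [N NN hN] := cl r N0 r0; exists N; split=> [k Nk|e e0].
  apply: step; first exact: leq_trans Nk.
  have := stay r N (lexx r) NN hN k Nk; have := W0 k; lra.
have e'0 : 0 < Num.min e r by rewrite lt_min e0.
have [N' NN' hN'] := cl _ N0 e'0; exists N' => k N'k.
have := stay _ N' _ NN' hN' k N'k; rewrite ge_min lexx orbT lt_min => /(_ isT).
move=> /andP[h _]; have := W0 k; lra.
Qed.

End Trap.

(** Compactness of the unit ball of row vectors, transported by transposition. *)
Lemma sphere_cluster {R : realType} {n : nat} (x : nat -> 'cV[R]_n) :
  (forall k, enorm (x k) = 1) -> exists2 xb, enorm xb = 1 &
  forall e N, 0 < e -> exists2 k, (N <= k)%N & enorm (x k - xb) < e.
Proof.
move=> x1; pose A := [set u : 'rV[R]_n | `|u| <= 1].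
have normT m p (u : 'M[R]_(m, p)) : `|u^T| <= `|u|.
  have -> : `|u^T| = mx_norm u^T by []; have -> : `|u| = mx_norm u by [].
  have [->|/eqP/eqP/mx_norm_neq0[[i j] ->]/=] := eqVneq (mx_norm u^T) 0.
    exact: (normr_ge0 u).
  by rewrite mxE mx_normrE; exact: (le_bigmax _ (fun k => `|u k.1 k.2|) (j, i)).
have cA : compact A.
  apply: bounded_closed_compact.
    by exists 1; split=> // M M1 u /= /le_trans; apply; exact: ltW.
  have -> : A = (fun u : 'rV[R]_n => `|u|) @^-1` [set t | t <= 1] by [].
  apply: closed_comp => [u _|]; [exact: norm_continuous|exact: closed_le].
have FA : ((fun k => (x k)^T) @ \oo) A.
  exists 0%N => // k _ /=; apply: le_trans (normT _ _ _) _.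
  by apply: le_trans (ler_mxnorm_enorm _) _; rewrite x1.
have [u [_ uc]] := cA _ _ FA.
have cl e N : 0 < e -> exists2 k, (N <= k)%N & enorm (x k - u^T) < e.
  move=> e0; have d0 : 0 < e / (n%:R + 1) by rewrite divr_gt0// ltr_wpDl.
  pose P := [set w : 'rV[R]_n | exists2 k, (N <= k)%N & w = (x k)^T].
  have FP : ((fun k => (x k)^T) @ \oo) P by exists N => // k Nk; exists k.
  have [_ [[k Nk ->] hk]] := uc _ _ FP (nbhsx_ballx u _ d0).
  exists k => //; apply: le_lt_trans (ler_enorm_mxnorm _) _.
  rewrite mulrC -ltr_pdivlMr; last by rewrite ltr_wpDl.
  move: hk; rewrite -ball_normE /= distrC; apply: le_lt_trans.
  by have := normT _ _ ((x k)^T - u); rewrite linearB /= trmxK.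
exists u^T => //; apply/eqP; rewrite eq_le; apply/andP; split.
  apply/ler_addgt0Pr => e e0; have [k _ hk] := cl e 0%N e0.
  have := enorm_normB (x k) u^T; rewrite x1 ler_norml; lra.
apply/ler_addgt0Pr => e e0; have [k _ hk] := cl e 0%N e0.
have := enorm_normB (x k) u^T; rewrite x1 ler_norml; lra.
Qed.

(** An abstract inertial method: [D] measures the steps, [w] is a sequence of
    subgradients, and [G] decreases up to multiples of the squared steps.  The
    energy [E] vanishes in the limit, and [s] is the sum of two consecutive steps,
    which bounds [w]. *)
Section InertialDescent.
Context {R : realType} {n : nat}.
Variables (x w : nat -> 'cV[R]_n) (G : 'cV[R]_n -> R) (cc delta Cw : R).
Let D k := enorm (x k - x k.-1).
Hypotheses (cc0 : 0 <= cc) (delta0 : 0 < delta) (Cw0 : 0 <= Cw).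
Hypothesis x1 : forall k, enorm (x k) = 1.
Hypothesis descent : forall k,
  G (x k.+1) + cc * D k.+1 ^+ 2 + delta * (D k.+1 ^+ 2 + D k ^+ 2)
  <= G (x k) + cc * D k ^+ 2.
Hypothesis w_le : forall k, enorm (w k.+1) <= Cw * (D k.+1 + D k).
Hypothesis G_cont : forall xb, enorm xb = 1 -> forall e, 0 < e ->
  exists2 r, 0 < r & forall y, enorm y = 1 -> enorm (y - xb) < r -> `|G y - G xb| < e.
Hypothesis lojasiewicz : forall xb, enorm xb = 1 -> exists r K, [/\ 0 < r, 0 <= K &
  forall k, enorm (x k.+1 - xb) < r ->
    `|G (x k.+1) - G xb| ^+ 3 <= K * enorm (w k.+1) ^+ 4].

Let s k := D k + D k.-1.

Lemma step_ge0 k : 0 <= D k. Proof. exact: enorm_ge0. Qed.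

Lemma step_le2 k : D k <= 2.
Proof.
by apply: le_trans (ler_enormD _ _) _; rewrite enormN !x1; lra.
Qed.

Lemma two_steps_ge0 k : 0 <= s k. Proof. by rewrite addr_ge0 ?step_ge0. Qed.

Variable xb : 'cV[R]_n.
Hypothesis xb1 : enorm xb = 1.
Hypothesis cluster : forall e N, 0 < e ->
  exists2 k, (N <= k)%N & enorm (x k - xb) < e.

Let E k := G (x k) + cc * D k ^+ 2 - G xb.

Lemma energy_gap k : delta / 2 * s k.+1 ^+ 2 <= E k - E k.+1.
Proof.
have := descent k; have : s k.+1 ^+ 2 <= 2 * (D k.+1 ^+ 2 + D k ^+ 2).
  by rewrite /s /=; have := sqr_ge0 (D k.+1 - D k); lra.
by move=> /(ler_wpM2l (ltW delta0)); rewrite /E; lra.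
Qed.

Lemma energy_nonincreasing k : E k.+1 <= E k.
Proof.
rewrite -subr_ge0; apply: le_trans (energy_gap k).
by rewrite mulr_ge0 ?sqr_ge0// divr_ge0// ltW.
Qed.

Lemma energy_antitone j k : (j <= k)%N -> E k <= E j.
Proof. exact: ((nonincreasing_seqP E).1 energy_nonincreasing). Qed.

(** The energy does not increase and comes close to nonnegative values along
    the indices at which [x] is close to [xb]. *)
Lemma energy_ge0 k : 0 <= E k.
Proof.
apply/ler_addgt0Pr => e e0; have [r r0 hr] := G_cont xb1 e0.
have [j kj jr] := cluster k r0; apply: le_trans (lerD (energy_antitone kj) (lexx e)).
have := hr _ (x1 j) jr; rewrite ltr_norml /E.
have : 0 <= cc * D j ^+ 2 by rewrite mulr_ge0 ?sqr_ge0.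
lra.
Qed.

Lemma two_steps_small e : 0 < e -> exists N, forall k, (N <= k)%N -> s k < e.
Proof.
move=> e0; have e1 : 0 < delta / 2 * e ^+ 2.
  by rewrite mulr_gt0 ?exprn_gt0// divr_gt0.
have [N hN] := nonincreasing_gap energy_ge0 energy_nonincreasing e1; exists N.+1 => -[//|k] Nk.
have d2 : 0 < delta / 2 by rewrite divr_gt0.
rewrite -(@ltr_pXn2r _ 2)// ?nnegrE ?two_steps_ge0//; last exact: ltW.
by rewrite -(ltr_pM2l d2); apply: le_lt_trans (energy_gap k) (hN _ Nk).
Qed.

Lemma energy_small e : 0 < e -> exists N, forall k, (N <= k)%N -> E k < e.
Proof.
move=> e0; have e2 : 0 < e / 2 by rewrite divr_gt0.
have [r r0 hr] := G_cont xb1 e2.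
have q0 : 0 < Num.min 1 (e / (2 * (cc + 1))).
  by rewrite lt_min ltr01 divr_gt0// mulr_gt0// ltr_wpDl.
have [N hN] := two_steps_small q0; have [j Nj jr] := cluster N r0; exists j => k jk.
apply: le_lt_trans (energy_antitone jk) _.
have := hr _ (x1 j) jr; rewrite ltr_norml => /andP[_ h1].
have := hN j Nj; rewrite lt_min ltr_pdivlMr; last by rewrite mulr_gt0// ltr_wpDl.
move=> /andP[h2 h3]; have D0 := step_ge0 j; have D1 := step_ge0 j.-1.
have h4 : D j <= 1 by rewrite /s in h2; lra.
have h5 : (cc + 1) * D j ^+ 2 <= (cc + 1) * D j.
  by rewrite ler_wpM2l ?addr_ge0//; nra.
have h6 : (cc + 1) * D j <= (cc + 1) * s j.
  by rewrite ler_wpM2l ?addr_ge0// /s; lra.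
have := sqr_ge0 (D j); rewrite /E; lra.
Qed.

Lemma energy_cube_le r K k : (forall k, enorm (x k.+1 - xb) < r ->
    `|G (x k.+1) - G xb| ^+ 3 <= K * enorm (w k.+1) ^+ 4) -> 0 <= K ->
  enorm (x k.+1 - xb) < r ->
  E k.+1 ^+ 3 <= 4 * (K * Cw ^+ 4 + 4 * cc ^+ 3) * s k.+1 ^+ 4.
Proof.
move=> hl K0 kr; have D0 := step_ge0 k.+1; have Dk0 := step_ge0 k.
set u := `|G (x k.+1) - G xb|; set v := cc * D k.+1 ^+ 2.
have u0 : 0 <= u by exact: normr_ge0.
have v0 : 0 <= v by rewrite mulr_ge0 ?sqr_ge0.
have h1 : E k.+1 ^+ 3 <= (u + v) ^+ 3.
  rewrite lerXn2r ?nnegrE ?energy_ge0 ?addr_ge0// /E addrAC lerD2r; exact: ler_norm.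
have h2 : (u + v) ^+ 3 <= 4 * (u ^+ 3 + v ^+ 3).
  have : 0 <= (u + v) * (u - v) ^+ 2 by rewrite mulr_ge0 ?sqr_ge0 ?addr_ge0.
  lra.
have h3 : u ^+ 3 <= K * Cw ^+ 4 * s k.+1 ^+ 4.
  apply: le_trans (hl k kr) _; rewrite -mulrA -exprMn ler_wpM2l//.
  by rewrite lerXn2r ?nnegrE ?enorm_ge0 ?mulr_ge0 ?two_steps_ge0// w_le.
have h4 : v ^+ 3 <= 4 * cc ^+ 3 * s k.+1 ^+ 4.
  have h5 : D k.+1 ^+ 2 * D k.+1 ^+ 4 <= 2 ^+ 2 * s k.+1 ^+ 4.
    apply: ler_pM; rewrite ?exprn_ge0//; rewrite lerXn2r ?nnegrE ?two_steps_ge0//.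
      exact: step_le2.
    by rewrite /s lerDl.
  have := ler_wpM2l (exprn_ge0 3 cc0) h5; rewrite /v; lra.
lra.
Qed.

Theorem inertial_descent_converges :
  (exists M, forall N, \sum_(0 <= k < N) D k.+1 <= M) /\
  (forall e, 0 < e -> exists N, forall k, (N <= k)%N -> enorm (x k - xb) < e).
Proof.
have [r [K [r0 K0 hl]]] := lojasiewicz xb1.
pose K' := 4 * (K * Cw ^+ 4 + 4 * cc ^+ 3).
have K'0 : 0 <= K' by rewrite mulr_ge0// addr_ge0// mulr_ge0// exprn_ge0.
pose C := 4 * (1 + K') / (delta / 2).
have d2 : 0 < delta / 2 by rewrite divr_gt0.
have C0 : 0 <= C by rewrite divr_ge0 ?mulr_ge0 ?addr_ge0// ltW.
pose W k := s k + C * Num.sqrt (Num.sqrt (E k)).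
have W0 k : 0 <= W k by rewrite addr_ge0 ?two_steps_ge0// mulr_ge0 ?sqrtr_ge0.
have [N [hW conv]] : exists N,
    (forall k, (N <= k)%N -> W k.+1 + enorm (x k.+1 - x k) <= W k) /\
    forall e, 0 < e -> exists N', forall k, (N' <= k)%N -> enorm (x k - xb) < e.
  apply: (@trapped_near_cluster _ _ x xb W W0 r 1 r0).
    move=> [//|k] _ kr.
    have := sqrt_sqrt_step d2 K'0 (two_steps_ge0 k.+1) (energy_ge0 _) (energy_nonincreasing k.+1)
      (energy_cube_le hl K0 kr) (energy_gap k.+1).
    have : D k.+2 <= s k.+2 by rewrite /s lerDl step_ge0.
    by rewrite /W /C /D /=; lra.
  move=> e N e0; have e3 : 0 < e / 3 by rewrite divr_gt0.
  have C1 : 0 < C + 1 by rewrite ltr_wpDl.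
  have e4 : 0 < (e / (3 * (C + 1))) ^+ 4 by rewrite exprn_gt0// divr_gt0// mulr_gt0.
  have [N1 hN1] := two_steps_small e3; have [N2 hN2] := energy_small e4.
  have [k] := cluster (maxn N (maxn N1 N2)) e3.
  rewrite !geq_max => /andP[Nk /andP[N1k N2k]] kr; exists k => //.
  have hp : Num.sqrt (Num.sqrt (E k)) < e / (3 * (C + 1)).
    rewrite -(@ltr_pXn2r _ 4)// ?nnegrE ?sqrtr_ge0//; last first.
      by rewrite divr_ge0 ?mulr_ge0 ?ltW.
    by rewrite (exprM _ 2 2) !sqr_sqrtr ?sqrtr_ge0 ?energy_ge0// hN2.
  rewrite ltr_pdivlMr ?mulr_gt0// in hp.
  have := hN1 k N1k; have := sqrtr_ge0 (Num.sqrt (E k)); rewrite /W; lra.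
split=> //; exists (\sum_(0 <= k < N) D k.+1 + W N) => m.
have tail j : \sum_(N <= k < N + j) D k.+1 <= W N - W (N + j)%N.
  elim: j => [|j IH]; first by rewrite addn0 big_geq// subrr.
  rewrite addnS big_nat_recr ?leq_addr//=.
  have := hW (N + j)%N (leq_addr _ _); rewrite /D /=; lra.
have mono a b : (a <= b)%N -> \sum_(0 <= k < a) D k.+1 <= \sum_(0 <= k < b) D k.+1.
  move=> ab; rewrite (big_cat_nat (n := a) (p := b))//= lerDl.
  by apply: sumr_ge0 => k _; exact: step_ge0.
apply: le_trans (mono m (N + m)%N (leq_addl _ _)) _.
rewrite (big_cat_nat (n := N))//= ?leq_addr// lerD2l.
have := tail m; have := W0 (N + m)%N; lra.
Qed.

(** With square roots in place of fourth roots, the potential [W k] is itself at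
    most [p * s k], so that losing [s k.+1] at each step is a geometric decrease. *)
Theorem inertial_descent_linear r eta c : 0 < r -> 0 < eta -> 0 <= c ->
  (forall k, enorm (x k.+1 - xb) < r -> G xb < G (x k.+1) ->
     G (x k.+1) < G xb + eta -> G (x k.+1) - G xb <= c * enorm (w k.+1) ^+ 2) ->
  exists c2 q, [/\ 0 < c2, 0 < q < 1 &
    exists N, forall k, (N <= k)%N -> enorm (x k - xb) <= c2 * q ^+ k].
Proof.
move=> r0 eta0 c0 hKL; have [_ conv] := inertial_descent_converges.
pose K := c * Cw ^+ 2 + cc.
have K0 : 0 <= K by rewrite addr_ge0// mulr_ge0// exprn_ge0.
have [N1 hN1] := conv r r0; have [N2 hN2] := energy_small eta0.
pose N := (maxn N1 N2).+1.
have EK k : (N <= k)%N -> E k <= K * s k ^+ 2.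
  case: k => // k; rewrite ltnS geq_max => /andP[N1k N2k].
  have D0 := step_ge0 k.+1; have D1 := step_ge0 k.
  have Ds : cc * D k.+1 ^+ 2 <= cc * s k.+1 ^+ 2.
    by rewrite ler_wpM2l// lerXn2r ?nnegrE ?two_steps_ge0// /s lerDl.
  have cs : 0 <= c * Cw ^+ 2 * s k.+1 ^+ 2 by rewrite !mulr_ge0 ?exprn_ge0 ?two_steps_ge0.
  have [Gle|Glt] := lerP (G (x k.+1)) (G xb); first by rewrite /E /K; lra.
  have h := hKL k (hN1 _ (leqW N1k)) Glt.
  have Geta : G (x k.+1) < G xb + eta.
    have := hN2 _ (leqW N2k); have := mulr_ge0 cc0 (sqr_ge0 (D k.+1)).
    rewrite /E; lra.
  have w2 : c * enorm (w k.+1) ^+ 2 <= c * (Cw * s k.+1) ^+ 2.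
    by rewrite ler_wpM2l// lerXn2r ?nnegrE ?enorm_ge0 ?mulr_ge0 ?two_steps_ge0// w_le.
  have := h Geta; rewrite /E /K; lra.
have d2 : 0 < delta / 2 by rewrite divr_gt0.
pose C := 4 * (1 + K) / (delta / 2).
have K1 : 0 <= 1 + K by rewrite addr_ge0.
have C0 : 0 <= C by apply: divr_ge0; [rewrite mulr_ge0|exact: ltW].
pose W k := s k + C * Num.sqrt (E k).
have W0 k : 0 <= W k by rewrite addr_ge0 ?two_steps_ge0// mulr_ge0 ?sqrtr_ge0.
have step k : (N <= k)%N -> W k.+1 + s k.+1 <= W k.
  move=> Nk; exact: sqrt_step d2 K0 (two_steps_ge0 k) (energy_ge0 _) (energy_nonincreasing k) (EK k Nk) (energy_gap k).
have travel k : (N <= k)%N -> enorm (x k - xb) <= W k.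
  move=> Nk; apply/ler_addgt0Pr => e e0; have [j kj jr] := cluster k e0.
  have step' i : (N <= i)%N -> W i.+1 + enorm (x i.+1 - x i) <= W i.
    move=> /step; have : D i.+1 <= s i.+1 by rewrite /s lerDl step_ge0.
    by rewrite /D /=; lra.
  have := travel_le_potential step' (j - k) Nk; rewrite subnKC// enormB.
  have := ler_enorm_dist (x k) (x j) xb; have := W0 j; lra.
pose p := 1 + C * (1 + K); have p1 : 1 <= p.
  by rewrite lerDl mulr_ge0.
have Ws k : (N <= k)%N -> W k <= p * s k.
  move=> Nk; rewrite /W /p mulrDl mul1r lerD2l -mulrA ler_wpM2l//.
  rewrite -(@ler_pXn2r _ 2)// ?nnegrE ?sqrtr_ge0 ?(mulr_ge0 K1 (two_steps_ge0 k))//.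
  rewrite sqr_sqrtr ?energy_ge0//; apply: le_trans (EK k Nk) _; rewrite exprMn.
  by rewrite ler_wpM2r ?sqr_ge0//; nra.
pose t := p / (1 + p).
have t0 : 0 < t by rewrite divr_gt0; lra.
have t1 : t < 1 by rewrite ltr_pdivrMr; lra.
have rate k : (N <= k)%N -> W k.+1 <= t * W k.
  move=> Nk; rewrite mulrAC ler_pdivlMr; last by lra.
  have := Ws k.+1 (leqW Nk); have p0 : 0 <= p by lra.
  have := ler_wpM2l p0 (step k Nk); lra.
have geo j : W (N + j)%N <= t ^+ j * W N.
  elim: j => [|j IH]; first by rewrite addn0 expr0 mul1r.
  rewrite addnS; apply: le_trans (rate _ (leq_addr _ _)) _.
  by rewrite exprS -mulrA ler_wpM2l// ltW.
exists ((W N + 1) / t ^+ N), t; split.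
  by apply: divr_gt0; [rewrite ltr_wpDl|exact: exprn_gt0].
  by rewrite t0.
exists N => k Nk; apply: le_trans (travel k Nk) _.
rewrite -(subnKC Nk); apply: le_trans (geo _) _; rewrite exprD mulrA divfK; last first.
  by rewrite expf_neq0// gt_eqF.
by rewrite mulrC ler_wpM2r ?exprn_ge0 ?lerDl// ltW.
Qed.

End InertialDescent.

(** * The inertial proximal gradient iteration *)

(** The hypothesis on [tau] says that [varsigma / tau < 1 / tau - L], so the radicand
    is less than the square of [1 / tau - L]. *)
Lemma inertia_bound (R : realType) (L varsigma tau betamax : R) : 0 < L ->
  0 < varsigma < 1 -> 0 < tau < (1 - varsigma) * L^-1 ->
  0 < betamax <= Num.sqrt (varsigma * (tau^-1 - L) * tau^-1) / (2 * (tau^-1 + L)) ->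
  L < tau^-1 /\ tau^-1 * betamax ^+ 2 < (tau^-1 - L) / 4.
Proof.
move=> L0 /andP[v0 v1] /andP[t0 tL] /andP[b0 bmax].
have p0 : 0 < tau^-1 by rewrite invr_gt0.
have vp : varsigma * tau^-1 < tau^-1 - L.
  move: tL; rewrite ltr_pdivlMr// => h.
  rewrite -(ltr_pM2l t0) mulrBr divff ?gt_eqF// mulrCA divff ?gt_eqF//; lra.
have vp0 : 0 < varsigma * tau^-1 by rewrite mulr_gt0.
have Lp : L < tau^-1 by lra.
split=> //; set p := tau^-1 in vp vp0 Lp p0 bmax *.
have pL : 0 < 2 * (p + L) by lra.
have rad : 0 <= varsigma * (p - L) * p by rewrite !mulr_ge0 ?subr_ge0 ?ltW.
have bp : betamax * (2 * (p + L)) <= Num.sqrt (varsigma * (p - L) * p).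
  by rewrite -ler_pdivlMr.
have h1 : (betamax * (2 * (p + L))) ^+ 2 <= (varsigma * p) * (p - L).
  rewrite mulrAC -[leRHS]sqr_sqrtr//; apply: lerXn2r bp; rewrite nnegrE ?sqrtr_ge0//.
  by rewrite mulr_ge0// ltW.
have h2 : (varsigma * p) * (p - L) < (p - L) * (p - L) by rewrite ltr_pM2r ?subr_gt0.
have h3 : 4 * p * betamax ^+ 2 * (p + L) ^+ 2 < (p - L) * (p - L) * p.
  have : (betamax * (2 * (p + L))) ^+ 2 < (p - L) * (p - L) by exact: le_lt_trans h2.
  by rewrite -(ltr_pM2r p0); lra.
have q0 : 0 < (p + L) ^+ 2 by rewrite exprn_gt0//; lra.
rewrite -(ltr_pM2r q0).
have h4 : (p - L) * (p - L) * p <= (p - L) * (p + L) ^+ 2.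
  rewrite -mulrA ler_wpM2l ?subr_ge0 ?ltW//.
  have := mulr_gt0 L0 p0; have := sqr_ge0 L; lra.
lra.
Qed.

Section SphereProxClosed.
Context {R : realType} {n : nat} (tau kap : R).
Hypotheses (tau0 : 0 < tau) (kap0 : 0 <= kap).
Implicit Types (u x z xb : 'cV[R]_n).

(** On the unit sphere the squared distance to [u] is affine, which makes the condition
    stable under limits in both [x] and [u]. *)
Lemma sphere_prox_linear u x : sphere_prox tau kap u x <-> enorm x = 1 /\
  forall z, enorm z = 1 ->
    kap * norm1 x - tau^-1 * dotv u x <= kap * norm1 z - tau^-1 * dotv u z.
Proof.
have tE : tau^-1 = 2 * (2 * tau)^-1 by field; rewrite gt_eqF.
have key z y : enorm z = 1 -> (2 * tau)^-1 * enorm (z - u) ^+ 2 + y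
    = y - tau^-1 * dotv u z + (2 * tau)^-1 * (1 + enorm u ^+ 2).
  by move=> z1; rewrite tE !enorm_sqr !dotvE -enorm_sqr z1 (dotvC z u); ring.
split=> -[x1 h]; split=> // z z1; have := h z z1.
  by rewrite !key// lerD2r.
by rewrite !key// lerD2r.
Qed.

Lemma norm1_lipschitz x y : `|norm1 x - norm1 y| <= n%:R * enorm (x - y).
Proof.
rewrite /norm1 -sumrB; apply: le_trans (ler_norm_sum _ _ _) _.
rewrite -[n in n%:R]card_ord -sumr_const mulr_suml; apply: ler_sum => i _.
rewrite mul1r; apply: le_trans (ler_dist_dist _ _) _.
by have := ler_coord (x - y) i; rewrite !mxE.
Qed.

Lemma sphere_prox_closed u xb : enorm xb = 1 ->
  (forall e, 0 < e -> exists x' u', [/\ sphere_prox tau kap u' x',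
     enorm (x' - xb) < e & enorm (u' - u) < e]) ->
  sphere_prox tau kap u xb.
Proof.
move=> xb1 h; apply/sphere_prox_linear; split=> // z z1.
apply/ler_addgt0Pr => e e0.
pose c := kap * n%:R + tau^-1 * (2 + enorm u) + 1.
have p0 : 0 < tau^-1 by rewrite invr_gt0.
have kn : 0 <= kap * n%:R by rewrite mulr_ge0.
have pu : 0 <= tau^-1 * (2 + enorm u) by rewrite mulr_ge0 ?addr_ge0 ?enorm_ge0// ltW.
have c0 : 0 < c by rewrite /c; lra.
have [x' [u' [/sphere_prox_linear[x'1 hx'] xd ud]]] := h _ (divr_gt0 e0 c0).
rewrite ltr_pdivlMr// in xd; rewrite ltr_pdivlMr// in ud.
have := hx' z z1 => h0.
have h1 : kap * norm1 xb <= kap * norm1 x' + kap * (n%:R * enorm (x' - xb)).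
  rewrite -mulrDr ler_wpM2l//; have := norm1_lipschitz x' xb.
  by rewrite ler_norml; lra.
have h2 : dotv u z - dotv u xb <= dotv u' z - dotv u' x' + 2 * enorm (u' - u)
    + enorm u * enorm (x' - xb).
  have e1 := ler_dotv (u - u') (z - x').
  have e2 := ler_dotv u (x' - xb).
  have e3 : enorm (z - x') <= 2.
    by apply: le_trans (ler_enormD _ _) _; rewrite enormN z1 x'1; lra.
  have e4 := ler_wpM2l (enorm_ge0 (u - u')) e3.
  rewrite (enormB u u') in e1 e4; move: e1 e2; rewrite !dotvE; lra.
have h3 := ler_wpM2l (ltW p0) h2.
have [dm|dm] := lerP (enorm (x' - xb)) (enorm (u' - u)).
  have f1 := ler_wpM2l kn dm.
  have f2 := ler_wpM2l (ltW p0) (ler_wpM2l (enorm_ge0 u) dm).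
  have := enorm_ge0 (u' - u); rewrite /c in ud; lra.
have f2 := ler_wpM2l (ltW p0) (ltW dm).
have := enorm_ge0 (x' - xb); rewrite /c in xd; lra.
Qed.

End SphereProxClosed.

Section Objective.
Context {R : realType} {m n : nat} (A : 'M[R]_(m, n)) (lambda rho a sigma gamma : R).
Let F := Xi A lambda rho a sigma gamma.
Let kap := lambda * rho.
Let G x := F x + kap * norm1 x.
Variables (g : 'cV[R]_n -> 'cV[R]_n) (L tau : R).
Hypotheses (kap0 : 0 <= kap) (tau0 : 0 < tau) (L0 : 0 <= L).
Hypothesis lip : forall x y, enorm (g x - g y) <= L * enorm (x - y).
Hypothesis taylor : forall x d,
  `|F (x + d) - F x - dotv (g x) d| <= L / 2 * enorm d ^+ 2.

Lemma G_obj_sphere x : enorm x = 1 ->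
  G_obj A lambda rho a sigma gamma x = (G x)%:E.
Proof. by move=> x1; rewrite /G_obj h_reg_sphere. Qed.

Lemma prox_subgradient u x : sphere_prox tau kap u x ->
  regular_subdiff (G_obj A lambda rho a sigma gamma) x (tau^-1 *: (u - x) + g x).
Proof.
move=> hx; have [x1 _] := hx.
apply: (proximal_regular_subdiff (C := (2 * tau)^-1 + L / 2) (G_obj_sphere x1)) => z.
have [z1|z1] := pselect (enorm z = 1); last by rewrite /G_obj h_reg_off// addey// leey.
rewrite G_obj_sphere// lee_fin /G.
have := sphere_prox_le tau0 hx z1; have := taylor x (z - x).
rewrite (addrC x) subrK ler_norml dotvDl; lra.
Qed.

Lemma objective_continuous xb : enorm xb = 1 -> forall e, 0 < e ->
  exists2 r, 0 < r &
    forall y, enorm y = 1 -> enorm (y - xb) < r -> `|G y - G xb| < e.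
Proof.
move=> xb1 e e0; pose c := enorm (g xb) + L / 2 + kap * n%:R + 1.
have kn : 0 <= kap * n%:R by rewrite mulr_ge0.
have c0 : 0 < c by have := enorm_ge0 (g xb); have := L0; rewrite /c; lra.
exists (Num.min 1 (e / c)); first by rewrite lt_min ltr01 divr_gt0.
move=> y y1; rewrite lt_min => /andP[d1]; rewrite ltr_pdivlMr// => dc.
have := taylor xb (y - xb); rewrite (addrC xb) subrK => h1.
have h2 := cauchy_schwarz (g xb) (y - xb).
have h3 := ler_wpM2l kap0 (norm1_lipschitz y xb).
rewrite -[kap]ger0_norm// -normrM in h3.
have d0 := enorm_ge0 (y - xb).
have h4 : L / 2 * enorm (y - xb) ^+ 2 <= L / 2 * enorm (y - xb).
  apply: ler_wpM2l; first by rewrite divr_ge0.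
  by rewrite expr2 ler_piMr// ltW.
rewrite (ger0_norm kap0) in h3.
move: h1 h2 h3; rewrite /c in dc; rewrite /G !ler_norml ltr_norml; lra.
Qed.

(** The new step is compared with the extrapolated one through
    [|x' - x|^2 <= 2 (|x' - xt|^2 + |xt - x|^2)], where
    [xt - x = be *: (x - xp)]. *)
Lemma inertial_step_descent (be : R) xp x x' :
  enorm x = 1 -> 0 <= be -> L <= tau^-1 ->
  let xt := x + be *: (x - xp) in
  sphere_prox tau kap (xt - tau *: g xt) x' ->
  G x' + (tau^-1 - L) / 4 * enorm (x' - x) ^+ 2
  <= G x + tau^-1 * be ^+ 2 * enorm (x - xp) ^+ 2.
Proof.
move=> x1 be0 Lp xt [x'1 /(_ x x1)] hprox.
pose e := x' - xt; pose f := x - xt.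
have tE : (2 * tau)^-1 = tau^-1 / 2 by rewrite invfM mulrC.
have t1 : tau * tau^-1 = 1 by rewrite divff// gt_eqF.
have hx' := taylor xt e; have hx := taylor xt f.
have e1 : xt + e = x' by rewrite addrC subrK.
have e2 : xt + f = x by rewrite addrC subrK.
rewrite e1 in hx'; rewrite e2 in hx.
have e3 : x' - (xt - tau *: g xt) = e + tau *: g xt by rewrite opprB addrA addrAC.
have e4 : x - (xt - tau *: g xt) = f + tau *: g xt by rewrite opprB addrA addrAC.
have sq (y : 'cV[R]_n) : (2 * tau)^-1 * enorm (y + tau *: g xt) ^+ 2
    = tau^-1 / 2 * enorm y ^+ 2 + dotv (g xt) y + tau / 2 * enorm (g xt) ^+ 2.
  rewrite tE !enorm_sqr !dotvE (dotvC y (g xt)).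
  by field; rewrite gt_eqF.
rewrite e3 e4 !sq in hprox.
have nf : enorm f ^+ 2 = be ^+ 2 * enorm (x - xp) ^+ 2.
  rewrite /f /xt opprD addrA subrr sub0r enormN enormZ exprMn.
  by rewrite real_normK ?num_real.
have ne : enorm (x' - x) ^+ 2 <= 2 * (enorm e ^+ 2 + enorm f ^+ 2).
  have : enorm (x' - x) <= enorm e + enorm f.
    by rewrite /f (enormB x xt); exact: ler_enorm_dist.
  have s0 := enorm_ge0 e; have s1 := enorm_ge0 f; have s2 := enorm_ge0 (x' - x).
  move=> h; apply: (@le_trans _ _ ((enorm e + enorm f) ^+ 2)).
    by rewrite lerXn2r ?nnegrE ?addr_ge0.
  have := sqr_ge0 (enorm e - enorm f); lra.
have pL : 0 <= (tau^-1 - L) / 4 by rewrite divr_ge0// subr_ge0.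
have := ler_wpM2l pL ne; rewrite -[_ * be ^+ 2 * _]mulrA -nf.
move: hx hx'; rewrite !ler_norml /G; lra.
Qed.

Lemma inertial_subgradient_le (be bm : R) xp x x' : 0 <= be <= bm ->
  let xt := x + be *: (x - xp) in
  enorm (tau^-1 *: (xt - tau *: g xt - x') + g x')
  <= (tau^-1 + L) * (1 + bm) * (enorm (x' - x) + enorm (x - xp)).
Proof.
move=> /andP[be0 bebm] /=; set xt := x + be *: (x - xp).
have -> : tau^-1 *: (xt - tau *: g xt - x') + g x'
    = tau^-1 *: (xt - x') + (g x' - g xt).
  rewrite addrAC scalerBr scalerA mulVf ?gt_eqF// scale1r.
  by rewrite -addrA (addrC (- _)).
have p0 : 0 <= tau^-1 by rewrite invr_ge0 ltW.
apply: (@le_trans _ _ ((tau^-1 + L) * enorm (x' - xt))).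
  apply: le_trans (ler_enormD _ _) _; rewrite mulrDl; apply: lerD; last exact: lip.
  by rewrite enormZ ger0_norm// enormB.
rewrite -mulrA ler_wpM2l ?addr_ge0//.
have h1 : enorm (x' - xt) <= enorm (x' - x) + be * enorm (x - xp).
  rewrite /xt opprD addrA; apply: le_trans (ler_enormD _ _) _.
  by rewrite enormN enormZ ger0_norm.
have d0 := enorm_ge0 (x' - x); have d1 := enorm_ge0 (x - xp).
have h2 := ler_wpM2r d1 bebm; have h3 : 0 <= bm * enorm (x' - x).
  by rewrite mulr_ge0// (le_trans be0).
lra.
Qed.

End Objective.

Theorem theorem4p2 (R : realType) (m n : nat)
  (b : 'cV[R]_m) (hb : forall i, b i 0 = -1 \/ b i 0 = 1)
  (Phi : 'M[R]_(m, n))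
  (A : 'M[R]_(m, n)) (hA : A = diag_mx b^T *m Phi)
  (lambda rho a sigma gamma : R)
  (hlambda : 0 < lambda) (hrho : 0 < rho) (ha : 1 < a)
  (hsigma : 0 < sigma <= 1) (hgamma : 0 < gamma < sigma / 2)
  (L : R) (hL : L = lipschitz_const (gradient (Xi A lambda rho a sigma gamma)))
  (varsigma : R) (hvarsigma : 0 < varsigma < 1)
  (tau : R) (htau : 0 < tau < (1 - varsigma) * L^-1)
  (betamax : R)
  (hbetamax : 0 < betamax
     <= Num.sqrt (varsigma * (tau^-1 - L) * tau^-1) / (2 * (tau^-1 + L)))
  (beta : nat -> R) (hbeta : forall k, 0 <= beta k <= betamax)
  (x : nat -> 'cV[R]_n) (hx0 : @sphere R n (x 0%N))
  (hx : inertial_prox_seq A lambda rho a sigma gamma tau beta x) :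
  (\sum_(1 <= k <oo) (enorm (x k.+1 - x k))%:E < +oo)%E /\
  exists xstar : 'cV[R]_n,
    [/\ x k @[k --> \oo] --> xstar,
        stationary A lambda rho a sigma gamma tau xstar
      & KL_function (G_obj A lambda rho a sigma gamma) (1 / 2) ->
        exists (c2 varrho : R),
          [/\ 0 < c2, 0 < varrho < 1 &
            \forall k \near \oo, enorm (x k - xstar) <= c2 * varrho ^+ k]].
Proof.
have kap0 : 0 <= lambda * rho by rewrite mulr_ge0 ?ltW.
have [J [al [c [v FE]]]] := Xi_is_hinge_sum A lambda hrho ha hgamma.
set F := Xi A lambda rho a sigma gamma in FE *.
have taylor0 y d : `|F (y + d) - F y - dotv (hinge_grad al c v y) d|
    <= (\sum_j `|al j| * enorm (v j) ^+ 2) * enorm d ^+ 2.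
  by rewrite !FE; exact: hinge_sum_taylor.
have gradE := gradient_of_taylor taylor0.
pose g := hinge_grad al c v; rewrite -/F gradE -/g in hL.
have tau0 : 0 < tau by case/andP: htau.
have L0 : 0 < L.
  case/andP: htau => _; case/andP: hvarsigma => _ v1 h.
  have : 0 < (1 - varsigma) * L^-1 by exact: lt_trans h.
  by rewrite pmulr_rgt0 ?invr_gt0// subr_gt0.
have lip y z : enorm (g y - g z) <= L * enorm (y - z).
  by rewrite hL; apply: lipschitz_constP; rewrite -hL.
have taylor := descent_lemma taylor0 (ltW L0) lip.
have [Lp coef] := inertia_bound L0 hvarsigma htau hbetamax.
set p := tau^-1 in Lp coef.
have p0 : 0 < p by rewrite invr_gt0.
have bm0 : 0 < betamax by case/andP: hbetamax.
pose kap := lambda * rho; pose xt k := extrapolate beta x k.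
pose u k := xt k - tau *: g (xt k).
have hprox k : sphere_prox tau kap (u k) (x k.+1).
  apply/(prox_h_regP tau lambda rho (u k) (x k.+1) hx0).
  by have := hx k; rewrite /= -/F gradE.
have x1 k : enorm (x k) = 1 by case: k => [//|k]; case: (hprox k).
pose w k := tau^-1 *: (u k.-1 - x k) + g (x k).
pose G y := F y + kap * norm1 y.
pose a1 := (p - L) / 4; pose a2 := p * betamax ^+ 2.
have a20 : 0 <= a2 by rewrite mulr_ge0 ?sqr_ge0// ltW.
have cc0 : 0 <= (a1 + a2) / 2 by rewrite /a1; lra.
have delta0 : 0 < (a1 - a2) / 2 by rewrite /a1 /a2; lra.
have Cw0 : 0 <= (p + L) * (1 + betamax) by rewrite mulr_ge0// addr_ge0// ltW.
have descent k : G (x k.+1) + (a1 + a2) / 2 * enorm (x k.+1 - x k.+1.-1) ^+ 2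
    + (a1 - a2) / 2 * (enorm (x k.+1 - x k.+1.-1) ^+ 2 + enorm (x k - x k.-1) ^+ 2)
    <= G (x k) + (a1 + a2) / 2 * enorm (x k - x k.-1) ^+ 2.
  have [b0 bm] := andP (hbeta k).
  have := inertial_step_descent tau0 taylor (x1 k) b0 (ltW Lp) (hprox k).
  have : p * beta k ^+ 2 * enorm (x k - x k.-1) ^+ 2
      <= a2 * enorm (x k - x k.-1) ^+ 2.
    rewrite ler_wpM2r ?sqr_ge0// ler_wpM2l//; first exact: ltW.
    by rewrite lerXn2r ?nnegrE// ltW.
  by rewrite -/p -/F -/kap -/a1 -/(G _) -/(G (x k)) /=; lra.
have w_le k : enorm (w k.+1) <= (p + L) * (1 + betamax) *
    (enorm (x k.+1 - x k.+1.-1) + enorm (x k - x k.-1)).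
  exact: (inertial_subgradient_le tau0 (ltW L0) lip (x k.-1) (x k) (x k.+1) (hbeta k)).
have G_cont := objective_continuous kap0 (ltW L0) taylor.
have loj xb : enorm xb = 1 -> exists r K, [/\ 0 < r, 0 <= K & forall k,
    enorm (x k.+1 - xb) < r -> `|G (x k.+1) - G xb| ^+ 3 <= K * enorm (w k.+1) ^+ 4].
  move=> xb1; have [r [K [r0 K0 h]]] := hinge_l1_lojasiewicz al c v kap xb1.
  exists r, K; split=> // k kr; rewrite /G !FE.
  have [mu hmu] := sphere_prox_multiplier tau0 (hprox k).
  apply: (h _ _ mu (x1 _) kr) => i xi; rewrite /w mxE hmu//; ring.
have [xb xb1 cluster] := sphere_cluster x1.
have [[M sumM] conv] :=
  inertial_descent_converges cc0 delta0 Cw0 x1 descent w_le G_cont loj xb1 cluster.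
(* the extrapolated points converge too, so the proximal condition passes to the limit *)
have stat : sphere_prox tau kap (xb - tau *: g xb) xb.
  apply: sphere_prox_closed => // e e0.
  pose C := 1 + (1 + tau * L) * (1 + 2 * betamax).
  have tL : 0 <= tau * L by rewrite mulr_ge0 ?ltW.
  have C1 : 1 <= C by rewrite lerDl mulr_ge0 ?addr_ge0 ?mulr_ge0 ?ltW.
  have C0 : 0 < C by lra.
  have eC : 0 < e / C by rewrite divr_gt0.
  have [N hN] := conv _ eC.
  pose k := N.+1; have hk : enorm (x k - xb) < e / C by exact: hN.
  have hk1 : enorm (x k.-1 - xb) < e / C by exact: hN.
  exists (x k.+1), (u k); split; first exact: hprox.
    apply: lt_le_trans (hN _ _) _; first by rewrite /k leqW// leqW.
    by rewrite ler_pdivrMr// ler_peMr// ltW.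
  have xtd : enorm (xt k - xb) < (1 + 2 * betamax) * (e / C).
    have [b0 bm] := andP (hbeta k).
    have h1 : enorm (xt k - xb) <= enorm (x k - xb) + beta k * enorm (x k - x k.-1).
      rewrite /xt /extrapolate addrAC; apply: le_trans (ler_enormD _ _) _.
      by rewrite enormZ ger0_norm.
    have h2 : enorm (x k - x k.-1) <= e / C + e / C.
      apply: le_trans (ler_enorm_dist _ xb _) _.
      by rewrite (enormB xb); apply: lerD; exact: ltW.
    have h3 : beta k * enorm (x k - x k.-1) <= betamax * (e / C + e / C).
      by rewrite ler_pM// enorm_ge0.
    lra.
  have ud : enorm (u k - (xb - tau *: g xb)) <= (1 + tau * L) * enorm (xt k - xb).
    have -> : u k - (xb - tau *: g xb) = (xt k - xb) - tau *: (g (xt k) - g xb).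
      by rewrite /u scalerBr; apply/colP => i; rewrite !mxE; ring.
    apply: le_trans (ler_enormD _ _) _; rewrite enormN enormZ (gtr0_norm tau0) mulrDl mul1r.
    by rewrite lerD2l -mulrA; apply: ler_wpM2l; [exact: ltW|exact: lip].
  apply: le_lt_trans ud _.
  have tL1 : 0 < 1 + tau * L by rewrite ltr_pwDl.
  have := xtd; rewrite -(ltr_pM2l tL1) => /lt_le_trans; apply.
  have eCC : e = C * (e / C) by rewrite mulrCA divff ?mulr1// gt_eqF.
  rewrite [leRHS]eCC mulrA; apply: ler_wpM2r; first exact: ltW.
  by rewrite /C; lra.
split.
  apply: (@le_lt_trans _ _ M%:E); last exact: ltry.
  apply: lime_le; first by apply: is_cvg_nneseries => k _ _; rewrite lee_fin enorm_ge0.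
  apply: nearW => N; rewrite sumEFin lee_fin; apply: le_trans (sumM N).
  case: N => [|N]; first by rewrite !big_geq.
  by rewrite (big_cat_nat (n := 1%N) (m := 0%N))//= lerDr big_nat1 enorm_ge0.
exists xb; split.
- exact: cvg_enormP.
- rewrite /stationary /= -/F gradE; exact/(prox_h_regP _ _ _ _ _ hx0).
move=> KL.
have domxb : dom_subdiff (G_obj A lambda rho a sigma gamma) xb.
  eexists; apply: regular_limiting; exact: (prox_subgradient tau0 taylor stat).
have [r [eta [cK [r0 eta0 cK0 growth]]]] :=
  KL_half_growth (G_obj_sphere _ _ _ _ _ _ xb1) (KL _ domxb).
have [c2 [q [c20 q01 [N hN]]]] := inertial_descent_linear cc0 delta0 Cw0 x1 descent w_le G_cont loj xb1
  cluster r0 eta0 (ltW cK0) (fun k kr lt1 lt2 => growth _ _ _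
    (G_obj_sphere _ _ _ _ _ _ (x1 k.+1)) kr lt1 lt2
    (regular_limiting (prox_subgradient tau0 taylor (hprox k)))).
by exists c2, q; split=> //; exists N.
Qed.
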